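(* Let $h\in\{0,1,\dots,N-1\}$, $\zeta\in(0,1)$, and suppose $\|\widetilde P_{h+1}-P_{h+1}^*\|\le a$. Let the step size be $$\alpha_{h,i}=\frac2\mu\,\frac1{i+\theta_h}\qquad\text{for}\qquad\theta_h=\max\left\{2,\frac{2L\xi_{h,3}}{\mu^2\widetilde J_h(K_{h,0})}\right\}.$$ Then for a given error tolerance $\varsigma>0$, the iterate $K_{h,T_h}$ of the update rule $K_{h,i+1}=K_{h,i}-\alpha_{h,i}\widehat\nabla\widetilde J_h(K_{h,i})$ after $$T_h=\left\lceil\frac{40}{7\mu\varsigma^2\zeta}\,\theta_h\,\widetilde J_h(K_{h,0})\right\rceil$$ steps satisfies $\|K_{h,T_h}-\widetilde K_h^*\|_F\le\varsigma$ with probability at least $1-\zeta$.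
   Context: Norms: $\|X\|$ is the spectral norm, $\|X\|_F$ the Frobenius norm, $\sigma_{\min}$ the minimum singular value, $\kappa_X$ the condition number; $\|X\|_*^2:=\sup_{z\ne0}\frac{z^\top X^\top P^*Xz}{z^\top P^*z}$. Setting: $A\in\mathbb{R}^{n\times n}$, $B\in\mathbb{R}^{n\times m}$, $(A,B)$ stabilizable; $Q\in\mathbb{R}^{n\times n}$, $R\in\mathbb{R}^{m\times m}$ symmetric positive definite. $\mathcal D$ is a distribution on $\mathbb{R}^n$ with $\mathbb E[x_0]=0$, $\mathbb E[x_0x_0^\top]=\Sigma_0\succ0$, $\|x_0\|^2\le C_m$ a.s. for some $C_m>0$. $P^*$ is the unique positive definite solution of $P=A^\top PA-A^\top PB(R+B^\top PB)^{-1}B^\top PA+Q$. $N\ge1$ is the horizon and $Q_N$ is a symmetric terminal matrix with $Q_N\succeq P^*$. Riccati difference equation: $P_N^*:=Q_N$, and for $t=N-1,\dots,0$, $P_t^*:=\mathcal R(P_{t+1}^* )$ with $\mathcal R(P):=Q+A^\top(P-PB(R+B^\top PB)^{-1}B^\top P)A$. Stage $h$: fixed downstream gains $\widetilde K_{h+1},\dots,\widetilde K_{N-1}\in\mathbb{R}^{m\times n}$ define $\widetilde P_N:=Q_N$ and $\widetilde P_t:=(A-B\widetilde K_t)^\top\widetilde P_{t+1}(A-B\widetilde K_t)+\widetilde K_t^\top R\widetilde K_t+Q$ for $t=N-1,\dots,h+1$. The surrogate cost is $\widetilde J_h(K):=\mathbb E_{x_0\sim\mathcal D}\big[x_0^\top\big(Q+K^\top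 RK+(A-BK)^\top\widetilde P_{h+1}(A-BK)\big)x_0\big]$ for $K\in\mathbb{R}^{m\times n}$, with minimizer $\widetilde K_h^*$. Let $Q_h(x_0,u_0):=x_0^\top Qx_0+u_0^\top Ru_0+(Ax_0+Bu_0)^\top\widetilde P_{h+1}(Ax_0+Bu_0)$. Fix $\sigma>0$. The gradient estimate is $\widehat\nabla\widetilde J_h(K):=-\frac1\sigma Q_h(x_0,-Kx_0+\sigma\eta)\,\eta x_0^\top$ with independent $x_0\sim\mathcal D$, $\eta\sim\mathcal N(0,I_m)$; at each iteration $i$ a fresh pair $(x_0,\eta)$, independent of the past, is drawn. The initial policy $K_{h,0}\in\mathbb{R}^{m\times n}$ is arbitrary and deterministic. Constants: $P_{\max}:=\|P^*\|+\kappa_{P^*}\|Q_N-P^*\|_*$, $a:=\sigma_{\min}(Q)/2$, $C_3:=2(\|R\|+(P_{\max}+a)\|B\|^2)$, $\mu:=4\sigma_{\min}(\Sigma_0)\sigma_{\min}(R)$, $L:=C_3\|\Sigma_0\|$, $\widetilde C_h:=\frac{10\zeta^{-1}\widetilde J_h(K_{h,0})+\widetilde J_h(\widetilde K_h^* )}{\sigma_{\min}(\Sigma_0)\sigma_{\min}(R)}$, $\xi_{h,1}:=\big(\|Q\|+2\|R\|\widetilde C_h+2(P_{\max}+a)(\|A\|^2+2\|B\|^2\widetilde C_h)\big)C_m^{3/2}$, $\xi_{h,2}:=2(\|R\|+2(P_{\max}+a)\|B\|^2)C_m^{1/2}$, $\xi_{h,3}:=\frac1{\sigma^2}\xi_{h,1}^2m+2\xi_{h,1}\xi_{h,2}m(m+2)+\sigma^2\xi_{h,2}^2m(m+2)(m+4)$.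 *)

(* Defs.v *)
From mathcomp Require Export all_boot all_order all_algebra complex.
From mathcomp Require Export all_classical all_reals all_analysis.

Set Implicit Arguments.
Unset Strict Implicit.
Unset Printing Implicit Defensive.

Export Order.TTheory GRing.Theory Num.Theory.
Export numFieldNormedType.Exports.

Local Open Scope classical_set_scope.
Local Open Scope ring_scope.

Section MatrixNotions.
Context {R : realType}.

(* R^n as a measurable space is the library's [n.-tuple R]; linear algebra
   happens on the corresponding column vector. *)
Definition colv (n : nat) (x : n.-tuple R) : 'cV[R]_n := \col_i tnth x i.

(* For column vectors this is the Euclidean norm. (The library's norm `|X| on
   matrices is the max norm, which is not used here.) *)
Definition frob_norm (p q : nat) (X : 'M[R]_(p, q)) : R :=
  Num.sqrt (\sum_i \sum_j X i j ^+ 2).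

Definition qform (n : nat) (X : 'M[R]_n) (z : 'cV[R]_n) : R :=
  (z^T *m X *m z) 0 0.

Definition posdef (n : nat) (X : 'M[R]_n) : Prop :=
  X^T = X /\ forall z : 'cV[R]_n, z != 0 -> 0 < qform X z.

Definition possemidef (n : nat) (X : 'M[R]_n) : Prop :=
  X^T = X /\ forall z : 'cV[R]_n, 0 <= qform X z.

Definition spectral_norm (p q : nat) (X : 'M[R]_(p, q)) : R :=
  sup [set frob_norm (X *m z) / frob_norm z | z in [set z : 'cV[R]_q | z != 0]].

Definition singular_values (n : nat) (X : 'M[R]_n) : set R :=
  [set Num.sqrt l | l in [set l : R | eigenvalue (X^T *m X) l]].

Definition sigma_min (n : nat) (X : 'M[R]_n) : R := inf (singular_values X).

Definition cond_number (n : nat) (X : 'M[R]_n) : R :=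
  spectral_norm X * spectral_norm (invmx X).

Definition star_norm (n : nat) (Pstar X : 'M[R]_n) : R :=
  Num.sqrt (sup [set qform (X^T *m Pstar *m X) z / qform Pstar z
                | z in [set z : 'cV[R]_n | z != 0]]).

Definition schur_stable (n : nat) (M : 'M[R]_n) : Prop :=
  forall z : R[i], eigenvalue (map_mx (real_complex R) M) z -> `|z| < 1.

Definition stabilizable (n m : nat) (A : 'M[R]_n) (B : 'M[R]_(n, m)) : Prop :=
  exists K : 'M[R]_(m, n), schur_stable (A - B *m K).

End MatrixNotions.

Section LQR.
Context {R : realType} {n m : nat}.
Variables (A : 'M[R]_n) (B : 'M[R]_(n, m)) (Q : 'M[R]_n) (Ru : 'M[R]_m).

Definition riccati_solution (P : 'M[R]_n) : Prop :=
  P = A^T *m P *m A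
      - A^T *m P *m B *m invmx (Ru + B^T *m P *m B) *m B^T *m P *m A + Q.

Definition riccati_op (P : 'M[R]_n) : 'M[R]_n :=
  Q + A^T *m (P - P *m B *m invmx (Ru + B^T *m P *m B) *m B^T *m P) *m A.

Definition policy_op (K : 'M[R]_(m, n)) (P : 'M[R]_n) : 'M[R]_n :=
  (A - B *m K)^T *m P *m (A - B *m K) + K^T *m Ru *m K + Q.

(* The value at time t of the backward recursion X_N = QN,
   X_s = f s X_(s+1); see backwardN and backwardS. *)
Definition backward (f : nat -> 'M[R]_n -> 'M[R]_n) (N : nat) (QN : 'M[R]_n)
    (t : nat) : 'M[R]_n :=
  foldr f QN (index_iota t N).

Lemma backwardN f N QN : backward f N QN N = QN.
Proof. by rewrite /backward /index_iota subnn. Qed.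

Lemma backwardS f N QN t : (t < N)%N ->
  backward f N QN t = f t (backward f N QN t.+1).
Proof.
by move=> ltN; rewrite /backward /index_iota -[(N - t)%N]prednK ?subn_gt0 -?subnS.
Qed.

Definition riccati_seq (N : nat) (QN : 'M[R]_n) (t : nat) : 'M[R]_n :=
  backward (fun=> riccati_op) N QN t.

(* Only the gains Kt s with t <= s < N matter. *)
Definition policy_seq (Kt : nat -> 'M[R]_(m, n)) (N : nat) (QN : 'M[R]_n)
    (t : nat) : 'M[R]_n :=
  backward (fun s => policy_op (Kt s)) N QN t.

(* In what follows P stands for the cost-to-go matrix at time h + 1. *)
Definition surrogate_cost (D : probability (n.-tuple R) R) (P : 'M[R]_n)
    (K : 'M[R]_(m, n)) : R :=
  \int[D]_x qform (Q + K^T *m Ru *m K + (A - B *m K)^T *m P *m (A - B *m K))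
                  (colv x).

Definition Qfun (P : 'M[R]_n) (x : 'cV[R]_n) (u : 'cV[R]_m) : R :=
  qform Q x + qform Ru u + qform P (A *m x + B *m u).

Definition grad_estimate (P : 'M[R]_n) (sigma : R) (K : 'M[R]_(m, n))
    (x : 'cV[R]_n) (eta : 'cV[R]_m) : 'M[R]_(m, n) :=
  - ((sigma^-1 * Qfun P x (- (K *m x) + sigma *: eta)) *: (eta *m x^T)).

Fixpoint pg_iterate (P : 'M[R]_n) (sigma : R) (alpha : nat -> R)
    (x : nat -> 'cV[R]_n) (eta : nat -> 'cV[R]_m) (K0 : 'M[R]_(m, n))
    (i : nat) : 'M[R]_(m, n) :=
  if i is j.+1 then
    let K := pg_iterate P sigma alpha x eta K0 j in
    K - alpha j *: grad_estimate P sigma K (x j) (eta j)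
  else K0.

End LQR.

Section Probability.
Context {R : realType} {d : measure_display} {Omega : measurableType d}.
Variable Pr : probability Omega R.

Definition mutually_independent (I : eqType) (F : I -> set (set Omega)) : Prop :=
  forall (J : seq I) (E : I -> set Omega), uniq J ->
    (forall j, j \in J -> F j (E j)) ->
    Pr (\bigcap_(j in [set` J]) E j) = (\prod_(j <- J) Pr (E j))%E.

Definition sigma_of {d' : measure_display} {T : measurableType d'}
    (X : Omega -> T) : set (set Omega) :=
  preimage_set_system setT X measurable.

Definition independent_samples {d1 d2 : measure_display}
    {T1 : measurableType d1} {T2 : measurableType d2}
    (x : nat -> Omega -> T1) (eta : nat -> Omega -> T2) : Prop :=
  mutually_independent (fun k : nat + nat =>
    match k with inl i => sigma_of (x i) | inr i => sigma_of (eta i) end).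

(* y has law N(0, I_m), i.e. its law is the m-fold product of N(0, 1),
   which is determined by its values on measurable boxes. *)
Definition standard_gaussian (m : nat) (y : Omega -> m.-tuple R) : Prop :=
  forall E : 'I_m -> set R, (forall j, measurable (E j)) ->
    Pr [set w | forall j, E j (tnth (y w) j)]
    = (\prod_(j < m) normal_prob 0 1 (E j))%E.

End Probability.

(* Main.v *)
From HB Require Import structures.
Require Import Defs.
From mathcomp Require Import measurable_realfun ring lra zify.

Set Implicit Arguments.
Unset Strict Implicit.
Unset Printing Implicit Defensive.

Local Open Scope classical_set_scope.
Local Open Scope ring_scope.

(** The surrogate cost [J] is a quadratic function of the gain: with [G := Ru + B^T *m P *m B],
    [J K - J Kstar] is the trace of [(K - Kstar)^T *m G *m (K - Kstar) *m Sigma0]. Writing [r] and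
    [s] for the least singular values of [Ru] and [Sigma0], the operator [D |-> G *m D *m Sigma0]
    is at least [r * s], so the gap [J K - J Kstar] controls [K - Kstar] ([cost_gap_ge]) and
    satisfies gradient domination with constant [mu = 4 * s * r] ([cost_grad_dom]). The smoothness
    constant involves an upper bound on the cost-to-go [P], which comes from the Riccati recursion
    ([riccati_seq_bound]): its iterates minus [Pstar] never grow relative to [Pstar], because the
    optimal closed loop is a contraction for the norm of [Pstar].

    The estimate of the gradient is a cubic polynomial in the Gaussian noise with coefficients that
    depend on the past and on the current state. Independence lets the noise monomials, and then
    the state monomials, be replaced by their means, which shows that the estimate is unbiased
    ([mean_grad_inner]); no conditional expectation is involved, only the factorization of the mean
    of a product ([mean_depends_onM]). Its second moment is at most [xi3] on the sublevel set where
    the gap is at most [M = 10 * zeta^-1 * J K0] ([ghat_le], [mean_H]): there the iterate is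
    bounded by coercivity of the cost, and the remaining bound is a polynomial in the squared norm
    of the noise, whose moments are those of the chi-squared distribution
    ([gaussian_sqnorm_moments]). They reduce to the moments of the normal law, obtained from
    Stein's identity ([normal_pdf_stein]).

    The process is therefore stopped when the gap exceeds [M]. With steps [2 / (mu * (i + theta))]
    the mean gap [u i] on survival satisfies
    [u i.+1 <= (1 - 2 / (i + theta)) * u i + beta / (i + theta) ^+ 2] with [beta <= theta * J K0],
    hence [u i <= theta * J K0 / (i + theta)] ([u_bound]), while keeping track of the mass lost by
    stopping gives a maximal inequality ([stop_bound]): the probability of stopping is at most
    [3 * J K0 / M = 3 / 10 * zeta]. At time [T] Markov's inequality bounds the probability of
    surviving far from [Kstar] by [7 / 10 * zeta] ([descent_whp]). *)

(** * Frobenius inner product and quadratic forms *)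

Section Frobenius.
Context {R : realType}.

Definition frob_dot p q (X Y : 'M[R]_(p, q)) : R :=
  \sum_i \sum_j X i j * Y i j.

Lemma frob_dotE p q (X Y : 'M[R]_(p, q)) : frob_dot X Y = \tr (X^T *m Y).
Proof.
rewrite /frob_dot exchange_big /mxtrace; apply: eq_bigr => j _.
by rewrite mxE; apply: eq_bigr => i _; rewrite mxE.
Qed.

Lemma frob_dotC p q (X Y : 'M[R]_(p, q)) : frob_dot X Y = frob_dot Y X.
Proof. by apply: eq_bigr => i _; apply: eq_bigr => j _; rewrite mulrC. Qed.

Lemma frob_dotDl p q (X Y Z : 'M[R]_(p, q)) :
  frob_dot (X + Y) Z = frob_dot X Z + frob_dot Y Z.
Proof. by rewrite !frob_dotE linearD mulmxDl mxtraceD. Qed.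

Lemma frob_dotZl p q a (X Y : 'M[R]_(p, q)) :
  frob_dot (a *: X) Y = a * frob_dot X Y.
Proof. by rewrite !frob_dotE linearZ -scalemxAl mxtraceZ. Qed.

Lemma frob_dotNl p q (X Y : 'M[R]_(p, q)) : frob_dot (- X) Y = - frob_dot X Y.
Proof. by rewrite -scaleN1r frob_dotZl mulN1r. Qed.

Lemma frob_dotBl p q (X Y Z : 'M[R]_(p, q)) :
  frob_dot (X - Y) Z = frob_dot X Z - frob_dot Y Z.
Proof. by rewrite frob_dotDl frob_dotNl. Qed.

Lemma frob_dotDr p q (X Y Z : 'M[R]_(p, q)) :
  frob_dot Z (X + Y) = frob_dot Z X + frob_dot Z Y.
Proof. by rewrite frob_dotC frob_dotDl !(frob_dotC _ Z). Qed.

Lemma frob_dotZr p q a (X Y : 'M[R]_(p, q)) :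
  frob_dot X (a *: Y) = a * frob_dot X Y.
Proof. by rewrite frob_dotC frob_dotZl frob_dotC. Qed.

Lemma frob_dotNr p q (X Y : 'M[R]_(p, q)) : frob_dot X (- Y) = - frob_dot X Y.
Proof. by rewrite frob_dotC frob_dotNl frob_dotC. Qed.

Definition frob_dotlin :=
  (@frob_dotDl, @frob_dotZl, @frob_dotNl,
   @frob_dotDr, @frob_dotZr, @frob_dotNr).

Lemma frob_dot_mulmxl p q r (X : 'M[R]_(p, q)) (Y : 'M[R]_(q, r)) Z :
  frob_dot (X *m Y) Z = frob_dot Y (X^T *m Z).
Proof. by rewrite !frob_dotE trmx_mul mulmxA. Qed.

Lemma frob_dot_mulmxr p q r (X : 'M[R]_(p, q)) (Y : 'M[R]_(q, r)) Z :
  frob_dot (X *m Y) Z = frob_dot X (Z *m Y^T).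
Proof. by rewrite !frob_dotE trmx_mul -mulmxA mxtrace_mulC mulmxA. Qed.

Lemma frob_dot_ge0 p q (X : 'M[R]_(p, q)) : 0 <= frob_dot X X.
Proof. by do 2!apply: sumr_ge0 => ? _; rewrite -expr2 sqr_ge0. Qed.

Lemma frob_dot0l p q (X : 'M[R]_(p, q)) : frob_dot 0 X = 0.
Proof. by rewrite frob_dotE trmx0 mul0mx mxtrace0. Qed.

Lemma frob_dot_eq0 p q (X : 'M[R]_(p, q)) : (frob_dot X X == 0) = (X == 0).
Proof.
apply/eqP/eqP => [|->]; last exact: frob_dot0l.
rewrite /frob_dot => /eqP; rewrite psumr_eq0; last first.
  by move=> i _; apply: sumr_ge0 => ? _; rewrite -expr2 sqr_ge0.
move=> /allP X0; apply/matrixP => i j; rewrite mxE.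
have := X0 i (mem_index_enum i); rewrite /= psumr_eq0; last first.
  by move=> ? _; rewrite -expr2 sqr_ge0.
by move=> /allP /(_ j (mem_index_enum j)) /=; rewrite mulf_eq0 orbb => /eqP.
Qed.

Lemma frob_dot_gt0 p q (X : 'M[R]_(p, q)) : (0 < frob_dot X X) = (X != 0).
Proof. by rewrite lt0r frob_dot_eq0 frob_dot_ge0 andbT. Qed.

Lemma sqr_frob_norm p q (X : 'M[R]_(p, q)) : frob_norm X ^+ 2 = frob_dot X X.
Proof.
rewrite sqr_sqrtr; last by do 2!apply: sumr_ge0 => ? _; rewrite sqr_ge0.
by apply: eq_bigr => i _; apply: eq_bigr => j _; rewrite expr2.
Qed.

Lemma frob_norm_ge0 p q (X : 'M[R]_(p, q)) : 0 <= frob_norm X.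
Proof. exact: sqrtr_ge0. Qed.

Lemma frob_norm0 p q : frob_norm (0 : 'M[R]_(p, q)) = 0.
Proof. by apply/eqP; rewrite -sqrf_eq0 sqr_frob_norm frob_dot0l. Qed.

Lemma frob_norm_gt0 p q (X : 'M[R]_(p, q)) : (0 < frob_norm X) = (X != 0).
Proof.
by rewrite -frob_dot_gt0 -sqr_frob_norm !lt0r sqrf_eq0 sqr_ge0 frob_norm_ge0.
Qed.

(** Nonpositive discriminant of a nonnegative quadratic, in a form that allows the leading
    coefficient [s] to vanish: besides the two Cauchy-Schwarz inequalities, it yields the first
    order condition at a minimizer. *)
Lemma discriminant_le (a b s : R) :
  (forall t, 0 <= a - 2 * t * b + t ^+ 2 * s) -> 0 <= a -> 0 <= s ->
  b ^+ 2 <= a * s.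
Proof.
move=> ab0 a0; rewrite le_eqVlt => /predU1P[sE|s0].
  rewrite -{s}sE in ab0 *; rewrite mulr0; have [->|b0] := eqVneq b 0; first by rewrite expr0n.
  have := ab0 ((a + 1) / (2 * b)).
  have -> : 2 * ((a + 1) / (2 * b)) * b = a + 1 by field.
  by rewrite mulr0; lra.
have := ab0 (b / s) => H.
have -> : b ^+ 2 = (a * s) - s * (a - 2 * (b / s) * b + (b / s) ^+ 2 * s).
  by field; rewrite gt_eqF.
by rewrite gerBl mulr_ge0// ltW.
Qed.

Lemma frob_dot_CS p q (X Y : 'M[R]_(p, q)) :
  frob_dot X Y ^+ 2 <= frob_dot X X * frob_dot Y Y.
Proof.
apply: discriminant_le; rewrite ?frob_dot_ge0// => t.
have := frob_dot_ge0 (X - t *: Y); rewrite !frob_dotlin (frob_dotC Y X).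
by congr (_ <= _); ring.
Qed.

Lemma frob_dot_le p q (X Y : 'M[R]_(p, q)) :
  frob_dot X Y <= frob_norm X * frob_norm Y.
Proof.
have := frob_dot_CS X Y; rewrite -!sqr_frob_norm -exprMn => H.
have h0 : 0 <= frob_norm X * frob_norm Y by rewrite mulr_ge0 ?frob_norm_ge0.
by rewrite (le_trans (ler_norm _))// -(@ler_pXn2r _ 2)// ?nnegrE// real_normK// num_real.
Qed.

Lemma frob_dot_mulmx_le p q r (X : 'M[R]_(p, q)) (Y : 'M[R]_(q, r)) :
  frob_dot (X *m Y) (X *m Y) <= frob_dot X X * frob_dot Y Y.
Proof.
have -> : frob_dot Y Y = \sum_j \sum_k Y k j ^+ 2.
  by rewrite exchange_big; do 2!apply: eq_bigr => ? _; rewrite expr2.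
have -> : frob_dot X X = \sum_i \sum_k X i k ^+ 2.
  by do 2!apply: eq_bigr => ? _; rewrite expr2.
rewrite mulr_suml; apply: ler_sum => i _; rewrite mulr_sumr.
apply: ler_sum => j _; rewrite -expr2 mxE.
have dotE (f g : 'I_q -> R) :
    frob_dot (\row_k f k) (\row_k g k) = \sum_k f k * g k.
  by rewrite /frob_dot big_ord1; apply: eq_bigr => k _; rewrite !mxE.
have sqE (f : 'I_q -> R) : \sum_k f k ^+ 2 = \sum_k f k * f k.
  by apply: eq_bigr => k _; rewrite expr2.
rewrite (sqE (X i)) (sqE (Y^~ j)) -!dotE; exact: frob_dot_CS.
Qed.

Lemma frob_dot_col k (u v : 'cV[R]_k) : frob_dot u v = \sum_a u a 0 * v a 0.
Proof. by apply: eq_bigr => a _; rewrite big_ord1. Qed.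

Lemma frob_dot_rows k l (X Y : 'M[R]_(k, l)) :
  frob_dot X Y = \sum_i frob_dot (row i X)^T (row i Y)^T.
Proof.
apply: eq_bigr => i _; apply: eq_bigr => j _.
by rewrite big_ord1 !mxE.
Qed.

Lemma frob_dotDD_le p q (X Y : 'M[R]_(p, q)) :
  frob_dot (X + Y) (X + Y) <= 2 * frob_dot X X + 2 * frob_dot Y Y.
Proof.
have := frob_dot_ge0 (X - Y); rewrite !(frob_dotDl, frob_dotNl, frob_dotDr, frob_dotNr).
by lra.
Qed.

Lemma qformE n (X : 'M[R]_n) z : qform X z = frob_dot z (X *m z).
Proof. by rewrite /qform frob_dotE /mxtrace big_ord1 mulmxA. Qed.

Lemma qformD n (X Y : 'M[R]_n) z : qform (X + Y) z = qform X z + qform Y z.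
Proof. by rewrite !qformE mulmxDl frob_dotlin. Qed.

Lemma qformB n (X Y : 'M[R]_n) z : qform (X - Y) z = qform X z - qform Y z.
Proof. by rewrite !qformE mulmxBl !frob_dotlin. Qed.

Lemma qform_congr p n (X : 'M[R]_p) (Y : 'M[R]_(p, n)) z :
  qform (Y^T *m X *m Y) z = qform X (Y *m z).
Proof. by rewrite !qformE frob_dot_mulmxl !mulmxA. Qed.

Lemma qform_addv n (X : 'M[R]_n) (y z : 'cV[R]_n) : X^T = X ->
  qform X (y + z) = qform X y + 2 * frob_dot y (X *m z) + qform X z.
Proof.
move=> sX; rewrite !qformE mulmxDr !frob_dotlin.
by rewrite [frob_dot z (X *m y)]frob_dotC frob_dot_mulmxl sX; ring.
Qed.

Lemma qformZv n (X : 'M[R]_n) a (z : 'cV[R]_n) :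
  qform X (a *: z) = a ^+ 2 * qform X z.
Proof. by rewrite !qformE -scalemxAr !frob_dotlin; ring. Qed.

Lemma psd_CS n (X : 'M[R]_n) (y z : 'cV[R]_n) : possemidef X ->
  frob_dot y (X *m z) ^+ 2 <= qform X y * qform X z.
Proof.
move=> [sX pX]; apply: discriminant_le => // t.
have := pX (y - t *: z); rewrite -scaleNr qform_addv// qformZv.
by rewrite -scalemxAr !frob_dotlin; congr (_ <= _); ring.
Qed.

Lemma posdef_semidef n (X : 'M[R]_n) : posdef X -> possemidef X.
Proof.
move=> [sX pX]; split=> // z; have [->|/pX/ltW//] := eqVneq z 0.
by rewrite qformE mulmx0 frob_dot0l.
Qed.

Lemma posdef_unit n (X : 'M[R]_n) : posdef X -> X \in unitmx.
Proof.
move=> [sX pX]; rewrite -row_free_unit; apply: contraT => /row_freePn[i /submxP Xi].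
have /rowV0Pn : kermx X != 0.
  rewrite kermx_eq0 row_free_unit -row_free_unit; apply/row_freePn.
  by exists i; apply/submxP.
move=> [v /sub_kermxP vX v0].
have : v^T != 0 by rewrite -(inj_eq (@trmx_inj _ _ _)) trmxK trmx0.
by move=> /pX; rewrite /qform trmxK vX mul0mx mxE ltxx.
Qed.

End Frobenius.

(** * Extremal eigenvalues and operator norms *)

Section Spectral.
Context {R : realType}.

Lemma psd_ker n (X : 'M[R]_n) (v : 'cV[R]_n) :
  possemidef X -> qform X v = 0 -> X *m v = 0.
Proof.
move=> pX v0; have := psd_CS (X *m v) v pX; rewrite v0 mulr0 => H.
by apply/eqP; rewrite -frob_dot_eq0 -sqrf_eq0 eq_le H sqr_ge0.
Qed.

(** The unit sphere is compact, so the Rayleigh quotient of [X] has a minimum [l], reached at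
    some [v]; then [X - l] is positive semidefinite with [v] in its isotropic cone, hence in its
    kernel. *)
Lemma sym_min_eigen n (X : 'M[R]_n) : (0 < n)%N -> X^T = X ->
  exists (l : R) (v : 'cV[R]_n),
    [/\ v != 0, X *m v = l *: v & forall z, l * frob_dot z z <= qform X z].
Proof.
move=> n0 sX.
pose S := [set r : 'rV[R]_n | frob_dot r r = 1].
pose f (r : 'rV[R]_n) := qform X r^T.
have cont_sum (I : finType) (F : I -> 'rV[R]_n -> R) :
    (forall i, continuous (F i)) -> continuous (fun r => \sum_i F i r).
  by move=> cF; apply: continuous_big => [|i _]; [exact: add_continuous|exact: cF].
have ccoord i j : continuous (fun r : 'rV[R]_n => r i j).
  by move=> r; exact: coord_continuous.
have cdot : continuous (fun r : 'rV[R]_n => frob_dot r r).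
  by do 2!apply: (cont_sum _ _) => ?; move=> r; apply: continuousM; exact: ccoord.
have cf : continuous f.
  have -> : f = fun r => \sum_(i < n) \sum_(j < 1) r 0 i * (\sum_(k < n) X i k * r 0 k).
    apply/funext => r; rewrite /f qformE; apply: eq_bigr => i _.
    rewrite !big_ord1 !mxE; congr (_ * _).
    by apply: eq_bigr => k _; rewrite mxE.
  do 2!apply: (cont_sum _ _) => ?; move=> r; apply: continuousM; first exact: ccoord.
  apply: (cont_sum _ _) => ? {}r; apply: continuousM; [exact: cst_continuous|exact: ccoord].
have Sne : S !=set0.
  exists (delta_mx 0 (Ordinal n0)); rewrite /S /= /frob_dot big_ord1.
  rewrite (bigD1 (Ordinal n0))//= big1 ?addr0 ?mxE ?eqxx ?mulr1//.
  by move=> j /negbTE j0; rewrite mxE j0 mul0r.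
have Scl : closed S.
  exact: (closed_comp (fun r _ => cdot r) (@closed_eq R 1)).
have Sbd : bounded_set S.
  exists 1; split; first exact: num_real.
  move=> M M1 r /= Sr; rewrite (le_trans _ (ltW M1))//.
  rewrite [leLHS]/Num.norm /= mx_normrE; apply/bigmax_leP; split => // -[i j] _ /=.
  rewrite -(@ler_pXn2r _ 2)// ?nnegrE// expr1n real_normK ?num_real// -Sr.
  rewrite /frob_dot (bigD1 i)//= (bigD1 j)//= -expr2 -addrA lerDl.
  by rewrite addr_ge0 ?sumr_ge0// => *; rewrite -?expr2 ?sqr_ge0// sumr_ge0// => *;
    rewrite -expr2 sqr_ge0.
have [r Sr minr] := EVT_min_rV Sne (bounded_closed_compact Sbd Scl)
  (continuous_subspaceT cf).
rewrite inE in Sr.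
have dotT (u : 'cV[R]_n) : frob_dot u^T u^T = frob_dot u u.
  by rewrite !frob_dotE trmxK mxtrace_mulC.
have Rayleigh (z : 'cV[R]_n) : f r * frob_dot z z <= qform X z.
  have [->|z0] := eqVneq z 0; first by rewrite qformE !mulmx0 !frob_dot0l mulr0.
  pose c := frob_norm z; have c0 : 0 < c by rewrite frob_norm_gt0.
  have Sz : (c^-1 *: z)^T \in S.
    rewrite inE /S /= dotT !frob_dotlin -sqr_frob_norm -/c.
    by field; rewrite gt_eqF.
  have := minr _ Sz; rewrite {2}/f trmxK qformZv -sqr_frob_norm -/c exprVn.
  by rewrite mulrC ler_pdivlMr// exprn_gt0.
exists (f r), r^T; split => //.
  by rewrite -frob_dot_eq0 -dotT trmxK Sr oner_neq0.
apply/eqP; rewrite -subr_eq0 -mul_scalar_mx -mulmxBl; apply/eqP.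
apply: psd_ker; last first.
  rewrite qformB -/(f r) qformE mul_scalar_mx frob_dotlin -dotT trmxK Sr.
  by rewrite mulr1 subrr.
split=> [|z]; first by rewrite linearB /= sX tr_scalar_mx.
by rewrite qformB [qform _%:M _]qformE mul_scalar_mx frob_dotlin subr_ge0.
Qed.

Lemma eigenvalue_col n (X : 'M[R]_n) (v : 'cV[R]_n) l : X^T = X ->
  v != 0 -> X *m v = l *: v -> eigenvalue X l.
Proof.
move=> sX v0 Xv; apply/eigenvalueP; exists v^T.
  by rewrite -{1}sX -trmx_mul Xv linearZ.
by rewrite -(inj_eq (@trmx_inj _ _ _)) trmxK trmx0.
Qed.

(** For a positive definite matrix the least singular value is the minimum of the Rayleigh
    quotient: the minimizer is an eigenvector, and every other singular value dominates the
    minimum by the Cauchy-Schwarz inequality. *)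
Lemma sigma_min_posdef n (X : 'M[R]_n) : (0 < n)%N -> posdef X ->
  [/\ 0 < sigma_min X, forall z, sigma_min X * frob_dot z z <= qform X z &
      exists2 v : 'cV[R]_n, v != 0 & X *m v = sigma_min X *: v].
Proof.
move=> n0 pX; have [sX pX0] := pX.
have [l [v [v0 Xv Rl]]] := sym_min_eigen n0 sX.
have l0 : 0 < l.
  have := pX0 v v0; rewrite qformE Xv frob_dotlin pmulr_lgt0//.
  by rewrite frob_dot_gt0.
suff -> : sigma_min X = l by split=> //; exists v.
apply/eqP; rewrite eq_le; apply/andP; split.
- apply: ge_inf; first by exists 0 => _ [x _ <-]; exact: sqrtr_ge0.
  exists (l ^+ 2); last by rewrite sqrtr_sqr gtr0_norm.
  apply: (@eigenvalue_col _ _ v) => //; first by rewrite trmx_mul trmxK.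
  by rewrite sX -mulmxA Xv -scalemxAr Xv scalerA.
- apply: lb_le_inf.
    exists (Num.sqrt (l ^+ 2)), (l ^+ 2) => //.
    apply: (@eigenvalue_col _ _ v) => //; first by rewrite trmx_mul trmxK.
    by rewrite sX -mulmxA Xv -scalemxAr Xv scalerA.
  move=> _ [x /eigenvalueP [w ww w0] <-].
  have wd0 : 0 < frob_dot w^T w^T.
    by rewrite frob_dot_gt0 -(inj_eq (@trmx_inj _ _ _)) trmxK trmx0.
  have xE : x * frob_dot w^T w^T = frob_dot (X *m w^T) (X *m w^T).
    rewrite frob_dot_mulmxl mulmxA.
    have -> : X^T *m X *m w^T = (w *m (X^T *m X))^T.
      by rewrite trmx_mul trmx_mul trmxK.
    by rewrite ww linearZ /= frob_dotlin.
  have := frob_dot_CS w^T (X *m w^T); rewrite -qformE -xE => CS.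
  have Rw := Rl w^T.
  have lx : l ^+ 2 <= x.
    have : (l * frob_dot w^T w^T) ^+ 2 <= x * frob_dot w^T w^T ^+ 2.
      apply: le_trans (le_trans CS _); last by rewrite le_eqVlt; apply/orP; left; apply/eqP; ring.
      by rewrite ler_pXn2r ?nnegrE// ?mulr_ge0 ?(le_trans _ Rw) ?mulr_ge0// ltW.
    by rewrite exprMn ler_pM2r// exprn_gt0.
  by rewrite -(ger0_norm (ltW l0)) -sqrtr_sqr ler_wsqrtr.
Qed.

Lemma spectral_norm_ub p q (X : 'M[R]_(p, q)) (z : 'cV[R]_q) :
  frob_norm (X *m z) <= spectral_norm X * frob_norm z.
Proof.
have [->|z0] := eqVneq z 0.
  by rewrite mulmx0 !frob_norm0 mulr0.
rewrite -ler_pdivrMr ?frob_norm_gt0//; apply: ub_le_sup; last by exists z.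
exists (frob_norm X) => _ [y y0 <-]; rewrite ler_pdivrMr ?frob_norm_gt0//.
rewrite -(@ler_pXn2r _ 2)// ?nnegrE ?mulr_ge0 ?frob_norm_ge0//.
by rewrite exprMn !sqr_frob_norm frob_dot_mulmx_le.
Qed.

Lemma spectral_norm_ge0 p q (X : 'M[R]_(p, q)) : 0 <= spectral_norm X.
Proof.
rewrite /spectral_norm; set S := (X in sup X).
have [[x Sx]|S0] := pselect (S !=set0); last first.
  rewrite (_ : S = set0) ?sup0//; apply/seteqP; split => // x Sx.
  by case: S0; exists x.
have [z z0 _] := Sx.
have := spectral_norm_ub X z; rewrite /spectral_norm -/S => H.
have nz : 0 < frob_norm z by rewrite frob_norm_gt0.
by rewrite -(pmulr_lge0 _ nz) (le_trans _ H)// frob_norm_ge0.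
Qed.

Lemma spectral_norm_dot p q (X : 'M[R]_(p, q)) (z : 'cV[R]_q) :
  frob_dot (X *m z) (X *m z) <= spectral_norm X ^+ 2 * frob_dot z z.
Proof.
rewrite -!sqr_frob_norm -exprMn ler_pXn2r// ?nnegrE
  ?mulr_ge0 ?frob_norm_ge0 ?spectral_norm_ge0//.
exact: spectral_norm_ub.
Qed.

Lemma qform_le_spectral n (X : 'M[R]_n) z :
  qform X z <= spectral_norm X * frob_dot z z.
Proof.
rewrite qformE (le_trans (frob_dot_le _ _))// -sqr_frob_norm expr2 mulrCA.
by rewrite ler_wpM2l ?frob_norm_ge0 ?spectral_norm_ub.
Qed.

(** The star norm is the operator norm of [X] for the scalar product of [P], and as such
    dominates every eigenvalue of [X]; the largest one bounds the quadratic form. *)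
Lemma qform_le_star_norm n (P X : 'M[R]_n) z : posdef P -> X^T = X ->
  qform X z <= star_norm P X * frob_dot z z.
Proof.
move=> pP sX; case: n => [|n] in P X z pP sX *.
  by rewrite [z]flatmx0 qformE mulmx0 !frob_dot0l mulr0.
(* The largest eigenvalue of [X] is the opposite of the least one of [- X]. *)
have [l [v [v0 Xv Rl]]] := sym_min_eigen (ltn0Sn n) (etrans (linearN _ X) (congr1 _ sX)).
have Xv' : X *m v = - l *: v by rewrite scaleNr -Xv mulNmx opprK.
apply: (@le_trans _ _ (- l * frob_dot z z)).
  by have := Rl z; rewrite !qformE mulNmx !frob_dotlin; lra.
rewrite ler_wpM2r ?frob_dot_ge0//.
have [s0 sP _] := sigma_min_posdef (ltn0Sn n) pP.
have Pv0 : 0 < qform P v by case: pP => _; exact.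
suff : l ^+ 2 <= star_norm P X ^+ 2.
  move=> l2; rewrite (le_trans (ler_norm _))// normrN.
  by rewrite -(@ler_pXn2r _ 2)// ?nnegrE ?sqrtr_ge0// real_normK ?num_real.
rewrite /star_norm; set S := (X in sup X).
have Sl : S (l ^+ 2).
  exists v => //; rewrite qform_congr Xv' qformZv sqrrN mulfK// gt_eqF//.
suff lS : l ^+ 2 <= sup S by rewrite sqr_sqrtr ?(le_trans _ lS)// sqr_ge0.
apply: ub_le_sup => //.
exists (spectral_norm P * spectral_norm X ^+ 2 / sigma_min P) => _ [y y0 <-].
have yd : 0 < frob_dot y y by rewrite frob_dot_gt0.
have Py : 0 < qform P y by case: pP => _; exact.
rewrite ler_pdivrMr// mulrAC ler_pdivlMr//.
apply: (@le_trans _ _ (spectral_norm P * spectral_norm X ^+ 2 * frob_dot y y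
                       * sigma_min P)).
  rewrite ler_pM2r// qform_congr (le_trans (qform_le_spectral _ _))// -mulrA.
  by rewrite ler_wpM2l ?spectral_norm_ge0 ?spectral_norm_dot.
rewrite -mulrA ler_wpM2l ?mulr_ge0 ?spectral_norm_ge0 ?exprn_ge0//.
by rewrite mulrC.
Qed.

End Spectral.

(** * Riccati recursion and the bound on the cost-to-go *)

Section Riccati.
Context {R : realType} {n m : nat}.
Variables (A : 'M[R]_n) (B : 'M[R]_(n, m)) (Q : 'M[R]_n) (Ru : 'M[R]_m).
Hypotheses (hQ : posdef Q) (hRu : posdef Ru).

(** Half the Hessian of the one-step cost in the control, for the cost-to-go [P]. *)
Definition ctrl_hess (P : 'M[R]_n) : 'M[R]_m := Ru + B^T *m P *m B.

(** Half the derivative of the one-step cost in the control, along the feedback [K]. *)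
Definition bellman_resid (P : 'M[R]_n) (K : 'M[R]_(m, n)) : 'M[R]_(m, n) :=
  ctrl_hess P *m K - B^T *m P *m A.

Lemma ctrl_hess_posdef P : possemidef P -> posdef (ctrl_hess P).
Proof.
move=> [sP pP]; have [sR pR] := hRu; split.
  by rewrite linearD /= !trmx_mul trmxK sP sR mulmxA.
by move=> z z0; rewrite qformD qform_congr ltr_wpDr// pR.
Qed.

(** The policy operator is quadratic in the gain; [bellman_resid] is its linear coefficient. *)
Lemma policy_opD P K D : P^T = P ->
  policy_op A B Q Ru (K + D) P = policy_op A B Q Ru K P
    + (D^T *m bellman_resid P K + (D^T *m bellman_resid P K)^T)
    + D^T *m ctrl_hess P *m D.
Proof.
move=> sP; have [sR _] := hRu.
have trD p q (X Y : 'M[R]_(p, q)) : (X + Y)^T = X^T + Y^T by rewrite linearD.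
have trN p q (X : 'M[R]_(p, q)) : (- X)^T = - X^T by rewrite linearN.
pose F := A - B *m K.
have -> : bellman_resid P K = Ru *m K - B^T *m P *m F.
  by rewrite /bellman_resid /ctrl_hess /F mulmxDl mulmxBr opprB addrA !mulmxA.
rewrite /policy_op /ctrl_hess.
have -> : A - B *m (K + D) = F - B *m D by rewrite mulmxDr opprD addrA.
rewrite -/F !(trD, trN, trmx_mul, trmxK, sP, sR, mulmxDl, mulmxDr, mulmxN,
  mulNmx, mulmxA, opprK).
by apply/matrixP => i j; rewrite !mxE; ring.
Qed.

Lemma qform_policy_op P K z : qform (policy_op A B Q Ru K P) z =
  qform P ((A - B *m K) *m z) + qform Ru (K *m z) + qform Q z.
Proof. by rewrite /policy_op !qformD !qform_congr. Qed.

Lemma policy_op_psd P K : possemidef P -> possemidef (policy_op A B Q Ru K P).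
Proof.
move=> [sP pP]; have [[sR _] [sQ _]] := (hRu, hQ).
have [[_ pR] [_ pQ]] := (posdef_semidef hRu, posdef_semidef hQ); split.
  rewrite /policy_op; move: (A - B *m K) => F.
  by rewrite !linearD /= !trmx_mul !trmxK sP sQ sR !mulmxA.
by move=> z; rewrite qform_policy_op !addr_ge0.
Qed.

Definition optimal_gain P := invmx (ctrl_hess P) *m (B^T *m P *m A).

Lemma bellman_resid_optimal P : possemidef P ->
  bellman_resid P (optimal_gain P) = 0.
Proof.
by move=> pP; rewrite /bellman_resid /optimal_gain mulKVmx ?subrr//;
  exact: posdef_unit (ctrl_hess_posdef pP).
Qed.

(** At the optimal gain the linear coefficient vanishes, so moving from there to the zero gain
    only adds the quadratic term, which is the one subtracted in the Riccati operator. *)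
Lemma riccati_opE P : possemidef P ->
  riccati_op A B Q Ru P = policy_op A B Q Ru (optimal_gain P) P.
Proof.
move=> pP; have [sP _] := pP; set K := optimal_gain P.
have GK : ctrl_hess P *m K = B^T *m P *m A.
  by apply/eqP; rewrite -subr_eq0; apply/eqP; exact: bellman_resid_optimal.
have [sG _] := ctrl_hess_posdef pP.
have KGK : (- K)^T *m ctrl_hess P *m - K
    = A^T *m (P *m B *m invmx (ctrl_hess P) *m B^T *m P) *m A.
  have -> : (- K)^T = - K^T by rewrite linearN.
  rewrite mulmxN !mulNmx opprK -{1}sG -trmx_mul GK.
  by rewrite !trmx_mul trmxK sP /K /optimal_gain !mulmxA.
have := policy_opD K (- K) sP.
rewrite subrr bellman_resid_optimal// mulmx0 trmx0 !addr0 KGK => /eqP.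
rewrite -subr_eq => /eqP <-.
rewrite /policy_op /riccati_op mulmx0 subr0 trmx0 mul0mx mul0mx addr0.
by rewrite mulmxBr mulmxBl -/(ctrl_hess P) addrA [Q + _]addrC.
Qed.

Lemma riccati_op_psd P : possemidef P -> possemidef (riccati_op A B Q Ru P).
Proof. by move=> pP; rewrite riccati_opE//; exact: policy_op_psd. Qed.

Lemma riccati_op_min P K z : possemidef P ->
  qform (riccati_op A B Q Ru P) z <= qform (policy_op A B Q Ru K P) z.
Proof.
move=> pP; have [sP _] := pP; rewrite riccati_opE//.
rewrite -[K](subrKC (optimal_gain P)) policy_opD//.
rewrite bellman_resid_optimal// mulmx0 trmx0 !addr0 qformD lerDl qform_congr.
by have [_] := posdef_semidef (ctrl_hess_posdef pP); exact.
Qed.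

Lemma riccati_solutionE P : riccati_solution A B Q Ru P ->
  riccati_op A B Q Ru P = P.
Proof.
move=> {2}->; rewrite /riccati_op mulmxBr mulmxBl addrC !mulmxA.
by [].
Qed.

(** Let [K] be the optimal gain for [Pstar]. The Riccati operator at [P] is dominated by the
    policy operator of [K], with equality at [Pstar], so the new gap is at most the old one
    evaluated at [(A - B *m K) *m z]; and [Pstar] does not increase along this closed loop,
    because it equals its own policy image, which adds nonnegative stage costs. *)
Lemma riccati_op_contract Pstar P c : posdef Pstar ->
  riccati_solution A B Q Ru Pstar -> possemidef P -> 0 <= c ->
  (forall z, qform (P - Pstar) z <= c * qform Pstar z) ->
  forall z, qform (riccati_op A B Q Ru P - Pstar) z <= c * qform Pstar z.
Proof.
move=> /posdef_semidef pPs /riccati_solutionE Ps pP c0 Pc z.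
have PsE := Ps; rewrite riccati_opE// in PsE.
set K := optimal_gain Pstar in PsE.
have zE : qform Pstar z = qform Pstar ((A - B *m K) *m z)
    + qform Ru (K *m z) + qform Q z by rewrite -{1}PsE qform_policy_op.
have [[_ pR] [_ pQ]] := (posdef_semidef hRu, posdef_semidef hQ).
rewrite qformB (@le_trans _ _ (qform (P - Pstar) ((A - B *m K) *m z)))//.
  rewrite zE qformB lerBlDr (le_trans (riccati_op_min K _ pP))//.
  by rewrite qform_policy_op le_eqVlt; apply/orP; left; apply/eqP; ring.
rewrite (le_trans (Pc _))// ler_wpM2l// zE -addrA lerDl addr_ge0//.
Qed.

Lemma backward_ind f N QN (T : 'M[R]_n -> Prop) t :
  T QN -> (forall s P, T P -> T (f s P)) -> T (@backward R n f N QN t).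
Proof. by move=> TN TS; rewrite /backward; elim: index_iota => //= s r; exact: TS. Qed.

(** The gap between the iterates and [Pstar], measured relative to [Pstar], never exceeds the
    initial one. The star norm bounds the initial gap in the Euclidean scale, and passing from
    that scale to the one of [Pstar] and back costs the condition number. *)
Lemma riccati_seq_bound Pstar QN N t z : posdef Pstar ->
  riccati_solution A B Q Ru Pstar -> QN^T = QN -> possemidef (QN - Pstar) ->
  qform (riccati_seq A B Q Ru N QN t) z <=
  (spectral_norm Pstar + cond_number Pstar * star_norm Pstar (QN - Pstar))
  * frob_dot z z.
Proof.
move=> pPs Ps sQN pQN.
have [n0|n0] := posnP n.
  have -> : z = 0 by apply/matrixP => i; have /(leq_trans (ltn0Sn i)) := ltn_ord i; lia.
  by rewrite qformE mulmx0 !frob_dot0l mulr0.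
have [s0 sP [v v0 Pv]] := sigma_min_posdef n0 pPs.
set st := star_norm _ _; pose c := st / sigma_min Pstar.
have st0 : 0 <= st by exact: sqrtr_ge0.
have c0 : 0 <= c by rewrite divr_ge0// ltW.
have [pP Pc] : possemidef (riccati_seq A B Q Ru N QN t) /\
    forall z, qform (riccati_seq A B Q Ru N QN t - Pstar) z <= c * qform Pstar z.
  apply: (@backward_ind _ _ _ (fun P => possemidef P /\
    forall z, qform (P - Pstar) z <= c * qform Pstar z)) => [|_ P [pP Pc]]; split.
  - split=> // y; rewrite -(subrK Pstar QN) qformD addr_ge0//; first exact: pQN.2.
    exact: (posdef_semidef pPs).2.
  - move=> y; apply: (le_trans (qform_le_star_norm y pPs pQN.1)).
    by rewrite -mulrA ler_wpM2l// ler_pdivlMl.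
  - exact: riccati_op_psd.
  - exact: riccati_op_contract.
have -> : qform (riccati_seq A B Q Ru N QN t) z
    = qform (riccati_seq A B Q Ru N QN t - Pstar) z + qform Pstar z.
  by rewrite qformB subrK.
rewrite addrC mulrDl lerD ?qform_le_spectral// (le_trans (Pc z))//.
have inv_ub : (sigma_min Pstar)^-1 <= spectral_norm (invmx Pstar).
  have v1 : 0 < frob_norm v by rewrite frob_norm_gt0.
  have := spectral_norm_ub (invmx Pstar) v.
  have -> : invmx Pstar *m v = (sigma_min Pstar)^-1 *: v.
    rewrite -[v in LHS](scalerK (lt0r_neq0 s0)) -Pv -scalemxAr.
    by rewrite mulKmx// posdef_unit.
  have -> a : frob_norm (a *: v) = `|a| * frob_norm v.
    apply/eqP; rewrite -(eqrXn2 (ltn0Sn 1)) ?mulr_ge0 ?frob_norm_ge0//.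
    by rewrite exprMn !sqr_frob_norm real_normK ?num_real// !frob_dotlin mulrA.
  by rewrite ler_pM2r// gtr0_norm// invr_gt0.
apply: (@le_trans _ _ (st / sigma_min Pstar * (spectral_norm Pstar
   * frob_dot z z))).
  by rewrite ler_wpM2l// qform_le_spectral.
rewrite -mulrA [leRHS](_ : _ = st * (spectral_norm (invmx Pstar) * (spectral_norm Pstar
   * frob_dot z z))); last by rewrite /cond_number; ring.
rewrite ler_wpM2l// ler_wpM2r// mulr_ge0 ?spectral_norm_ge0 ?frob_dot_ge0//.
Qed.

End Riccati.

(** * The surrogate cost as a quadratic function of the gain *)

Section Cost.
Context {R : realType} {n m : nat}.
Variables (A : 'M[R]_n) (B : 'M[R]_(n, m)) (Q : 'M[R]_n) (Ru : 'M[R]_m).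
Variables (P Sigma : 'M[R]_n) (p : R) (Kstar : 'M[R]_(m, n)).
Hypotheses (n0 : (0 < n)%N) (m0 : (0 < m)%N).
Hypotheses (hQ : posdef Q) (hRu : posdef Ru) (hP : possemidef P).
Hypotheses (hSigma : posdef Sigma) (hPp : forall z, qform P z <= p * frob_dot z z).
(* Immediate when [Sigma] is a covariance: the pairing is then the mean of [qform M]. It
   replaces square roots of positive semidefinite matrices. *)
Hypothesis trace_mono : forall M : 'M[R]_n,
  (forall z, 0 <= qform M z) -> 0 <= frob_dot M Sigma.

(** The surrogate cost, which depends on the law of the initial state only through its
    second moment [Sigma]. *)
Definition trace_cost (K : 'M[R]_(m, n)) : R :=
  frob_dot (policy_op A B Q Ru K P) Sigma.

Hypothesis Kmin : forall K, trace_cost Kstar <= trace_cost K.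

Local Notation G := (ctrl_hess B Ru P).
Local Notation s := (sigma_min Sigma).
Local Notation r := (sigma_min Ru).
Local Notation S := (spectral_norm Sigma).
Local Notation gB := (spectral_norm Ru + p * spectral_norm B ^+ 2).

Definition cost_gap (K : 'M[R]_(m, n)) : R := trace_cost K - trace_cost Kstar.

(** The gradient of [trace_cost], written around its minimizer [Kstar]. *)
Definition cost_grad (K : 'M[R]_(m, n)) : 'M[R]_(m, n) :=
  2 *: (G *m (K - Kstar) *m Sigma).

Let s0 : 0 < s. Proof. by case: (sigma_min_posdef n0 hSigma). Qed.
Let r0 : 0 < r. Proof. by case: (sigma_min_posdef m0 hRu). Qed.

Lemma frob_dot_congr_mono (M N : 'M[R]_n) :
  (forall z, qform M z <= qform N z) -> frob_dot M Sigma <= frob_dot N Sigma.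
Proof.
move=> MN; rewrite -subr_ge0 -frob_dotBl; apply: trace_mono => z.
by rewrite qformB subr_ge0.
Qed.

Lemma frob_dot_congr (M : 'M[R]_m) (D : 'M[R]_(m, n)) :
  frob_dot D (M *m D *m Sigma) = frob_dot (D^T *m M *m D) Sigma.
Proof.
have [sS _] := hSigma.
rewrite frob_dotC frob_dot_mulmxr sS -[D^T *m M *m D]mulmxA.
by rewrite [RHS]frob_dot_mulmxl trmxK.
Qed.

Lemma frob_dot_right_ge (D : 'M[R]_(m, n)) :
  s * frob_dot D D <= frob_dot D (D *m Sigma).
Proof.
have [sS _] := hSigma; have [_ lS _] := sigma_min_posdef n0 hSigma.
rewrite (frob_dot_rows D D) (frob_dot_rows D (D *m Sigma)) mulr_sumr.
by apply: ler_sum => i _; rewrite row_mul trmx_mul sS -qformE.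
Qed.

Lemma frob_dot_right_le (D : 'M[R]_(m, n)) :
  frob_dot D (D *m Sigma) <= S * frob_dot D D.
Proof.
have [sS _] := hSigma.
rewrite (frob_dot_rows D D) (frob_dot_rows D (D *m Sigma)) mulr_sumr.
by apply: ler_sum => i _; rewrite row_mul trmx_mul sS -qformE qform_le_spectral.
Qed.

Lemma scalar_congr c (D : 'M[R]_(m, n)) :
  frob_dot (D^T *m c%:M *m D) Sigma = c * frob_dot D (D *m Sigma).
Proof. by rewrite -frob_dot_congr mul_scalar_mx -scalemxAl frob_dotlin. Qed.

(** The factors are bounded one at a time: first [M], inside the trace against [Sigma], then
    [Sigma] on each row of [D]. *)
Lemma quad_ge (M : 'M[R]_m) c (D : 'M[R]_(m, n)) : 0 <= c ->
  (forall z, c * frob_dot z z <= qform M z) ->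
  c * s * frob_dot D D <= frob_dot D (M *m D *m Sigma).
Proof.
move=> c0 cM; rewrite frob_dot_congr -mulrA.
rewrite (le_trans (ler_wpM2l c0 (frob_dot_right_ge D)))// -scalar_congr.
apply: frob_dot_congr_mono => z; rewrite !qform_congr (le_trans _ (cM _))//.
by rewrite qformE mul_scalar_mx frob_dotlin.
Qed.

Lemma quad_le (M : 'M[R]_m) c (D : 'M[R]_(m, n)) : 0 <= c ->
  (forall z, qform M z <= c * frob_dot z z) ->
  frob_dot D (M *m D *m Sigma) <= c * S * frob_dot D D.
Proof.
move=> c0 cM; rewrite frob_dot_congr -mulrA.
rewrite (le_trans _ (ler_wpM2l c0 (frob_dot_right_le D)))// -scalar_congr.
apply: frob_dot_congr_mono => z; rewrite !qform_congr (le_trans (cM _))//.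
by rewrite qformE mul_scalar_mx frob_dotlin.
Qed.

Lemma psd_bound_ge0 : 0 <= p.
Proof.
have := hPp (const_mx 1); have := hP.2 (const_mx 1).
move=> /le_trans /[apply]; rewrite pmulr_lge0// frob_dot_gt0.
apply/negP => /eqP/matrixP/(_ (Ordinal n0) 0)/eqP; rewrite !mxE oner_eq0//.
Qed.

Lemma ctrl_hess_ge z : r * frob_dot z z <= qform G z.
Proof.
have [_ lR _] := sigma_min_posdef m0 hRu.
by rewrite qformD qform_congr (le_trans (lR z))// lerDl hP.2.
Qed.

Lemma ctrl_hess_le z : qform G z <= gB * frob_dot z z.
Proof.
rewrite qformD qform_congr mulrDl lerD ?qform_le_spectral// (le_trans (hPp _))//.
by rewrite -mulrA ler_wpM2l ?psd_bound_ge0// spectral_norm_dot.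
Qed.

Lemma trace_costD K D : trace_cost (K + D) = trace_cost K
  + 2 * frob_dot D (bellman_resid A B Ru P K *m Sigma)
  + frob_dot D (G *m D *m Sigma).
Proof.
have [sS _] := hSigma.
rewrite /trace_cost policy_opD//; last exact: hP.1.
rewrite !frob_dotlin frob_dot_congr; congr (_ + _ + _).
set E := bellman_resid _ _ _ _ _.
rewrite frob_dot_mulmxl trmxK trmx_mul trmxK frob_dot_mulmxl trmxK.
by rewrite frob_dotC frob_dot_mulmxr sS; ring.
Qed.

(** At the minimizer the linear term of the expansion vanishes in every direction, in
    particular in its own. *)
Lemma bellman_resid_min : bellman_resid A B Ru P Kstar *m Sigma = 0.
Proof.
set E := _ *m Sigma; apply/eqP; rewrite -frob_dot_eq0.
have : (- frob_dot E E) ^+ 2 <= 0 * frob_dot E (G *m E *m Sigma).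
  apply: discriminant_le => // [t|].
    have := Kmin (Kstar + t *: E); rewrite trace_costD -addrA lerDl.
    rewrite -!scalemxAr -!scalemxAl !frob_dotlin.
    by congr (_ <= _); ring.
  rewrite (le_trans _ (quad_ge E (ltW r0) ctrl_hess_ge))//.
  by rewrite mulr_ge0 ?frob_dot_ge0// mulr_ge0 ?ltW.
by rewrite mul0r sqrrN => H; rewrite -sqrf_eq0 eq_le H sqr_ge0.
Qed.

Lemma bellman_resid_grad K :
  2 *: (bellman_resid A B Ru P K *m Sigma) = cost_grad K.
Proof.
rewrite /cost_grad; congr (_ *: _); apply/eqP; rewrite -subr_eq0 -mulmxBl.
rewrite -bellman_resid_min; apply/eqP; congr (_ *m _).
by rewrite /bellman_resid mulmxBr opprB addrC addrA subrK.
Qed.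

Lemma cost_gapD K D : cost_gap (K + D) = cost_gap K
  + frob_dot D (cost_grad K) + frob_dot D (G *m D *m Sigma).
Proof.
by rewrite /cost_gap trace_costD -bellman_resid_grad frob_dotlin; ring.
Qed.

Lemma cost_gapE K : cost_gap K =
  frob_dot (K - Kstar) (G *m (K - Kstar) *m Sigma).
Proof.
rewrite /cost_gap -{1}[K](subrKC Kstar) trace_costD bellman_resid_min.
by rewrite frob_dotC frob_dot0l mulr0; ring.
Qed.

Lemma cost_gap_ge0 K : 0 <= cost_gap K.
Proof. by rewrite subr_ge0. Qed.

Lemma cost_gap_ge K : r * s * frob_dot (K - Kstar) (K - Kstar) <= cost_gap K.
Proof. by rewrite cost_gapE; exact: quad_ge (ltW r0) ctrl_hess_ge. Qed.

Lemma cost_quad_le D : frob_dot D (G *m D *m Sigma) <= gB * S * frob_dot D D.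
Proof.
by apply: quad_le ctrl_hess_le; rewrite addr_ge0 ?mulr_ge0 ?exprn_ge0
  ?spectral_norm_ge0 ?psd_bound_ge0.
Qed.

(** Gradient domination: the self-adjoint operator [D |-> G *m D *m Sigma] is at least
    [r * s], so that its quadratic form is at most its squared norm divided by [r * s]. *)
Lemma cost_grad_dom K :
  4 * r * s * cost_gap K <= frob_dot (cost_grad K) (cost_grad K).
Proof.
rewrite /cost_grad !frob_dotlin cost_gapE; set D := K - Kstar.
set TD := G *m D *m Sigma.
have c0 : 0 < r * s by rewrite mulr_gt0.
have DTD := quad_ge D (ltW r0) ctrl_hess_ge; rewrite -/TD in DTD.
have CS := frob_dot_CS D TD.
have [D0|D0] := eqVneq D 0.
  by rewrite D0 frob_dot0l mulr0 !mulr_ge0 ?frob_dot_ge0.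
have d0 : 0 < frob_dot D D by rewrite frob_dot_gt0.
have t0 : 0 < frob_dot D TD by apply: lt_le_trans DTD; rewrite mulr_gt0.
have : r * s * frob_dot D TD ^+ 2 <= frob_dot D TD * frob_dot TD TD.
  apply: (le_trans (ler_wpM2l (ltW c0) CS)); rewrite mulrA.
  by rewrite ler_wpM2r ?frob_dot_ge0.
rewrite expr2 [leLHS]mulrCA ler_pM2l// => H; lra.
Qed.

(** Among the three terms of the cost, the control cost alone is coercive in the gain; this keeps
    the iterates of bounded cost bounded. *)
Lemma trace_cost_ge K : r * s * frob_dot K K <= trace_cost K.
Proof.
have [_ lR _] := sigma_min_posdef m0 hRu.
apply: (le_trans (quad_ge K (ltW r0) lR)); rewrite frob_dot_congr.
apply: frob_dot_congr_mono => z; rewrite qform_policy_op qform_congr addrAC lerDr.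
by rewrite addr_ge0 ?hP.2 ?(posdef_semidef hQ).2.
Qed.

Lemma trace_cost_gt0 K : 0 < trace_cost K.
Proof.
have [q0 lQ _] := sigma_min_posdef n0 hQ.
have [_ lS _] := sigma_min_posdef n0 hSigma.
have trS : 0 < \tr Sigma.
  rewrite /mxtrace (bigD1 (Ordinal n0))//=.
  have dE i : Sigma i i = qform Sigma (delta_mx i 0).
    by rewrite /qform trmx_delta -rowE -colE !mxE.
  have d0 i : 0 < Sigma i i.
    rewrite dE; apply: hSigma.2; apply/eqP => /matrixP/(_ i 0)/eqP.
    by rewrite !mxE !eqxx oner_eq0.
  by rewrite ltr_wpDr ?sumr_ge0// => *; exact: ltW.
apply: (@lt_le_trans _ _ (frob_dot (sigma_min Q)%:M Sigma)).
  by rewrite frob_dotE tr_scalar_mx mul_scalar_mx mxtraceZ mulr_gt0.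
apply: frob_dot_congr_mono => z; rewrite qform_policy_op.
rewrite qformE mul_scalar_mx frob_dotlin (le_trans (lQ z))// lerDr.
by rewrite addr_ge0 ?hP.2 ?(posdef_semidef hRu).2.
Qed.

End Cost.

(** * Independence of generated sigma-algebras *)

Section Cylinders.
Context {R : realType} {d : measure_display} {Omega : measurableType d}.
Variable Pr : probability Omega R.
Context {I : eqType}.
Variable F : I -> set (set Omega).

(** The pi-system of the finite intersections of events from the classes [F j], [J j]. It
    generates the join of these classes. *)
Definition cylinders (J : pred I) : set (set Omega) :=
  [set E | exists s f, [/\ uniq s, forall j, j \in s -> J j, forall j, F j (f j) &
     E = \bigcap_(j in [set` s]) f j]].

Hypotheses (FT : forall i, F i setT) (FI : forall i, setI_closed (F i)).
Hypothesis Fm : forall i, F i `<=` measurable.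

Lemma cylindersI J : setI_closed (cylinders J).
Proof.
move=> _ _ [s1 [f1 [_ J1 F1 ->]]] [s2 [f2 [_ J2 F2 ->]]].
exists (undup (s1 ++ s2)), (fun j => (if j \in s1 then f1 j else setT) `&`
                              (if j \in s2 then f2 j else setT)); split.
- exact: undup_uniq.
- by move=> j; rewrite mem_undup mem_cat => /orP[/J1|/J2].
- by move=> j; apply: FI; case: ifP.
- apply/seteqP; split => [w [w1 w2] j _|w ws].
    by split; case: ifP => // js; [exact: w1|exact: w2].
  split=> j /= js.
    have /ws[] : [set` undup (s1 ++ s2)] j by rewrite /= mem_undup mem_cat js.
    by rewrite js.
  have /ws[_] : [set` undup (s1 ++ s2)] j by rewrite /= mem_undup mem_cat js orbT.
  by rewrite js.
Qed.

Lemma cylinders_measurable J : cylinders J `<=` measurable.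
Proof.
move=> _ [s [f [_ _ fF ->]]]; apply: fin_bigcap_measurable => [|j _].
  exact: finite_seq.
exact: Fm.
Qed.

Lemma sub_cylinders (J : pred I) j : J j -> F j `<=` cylinders J.
Proof.
move=> Jj E FE; exists [:: j], (fun i => if i == j then E else setT); split => //.
- by move=> i; rewrite inE => /eqP ->.
- by move=> i; case: eqP => [->|].
- apply/seteqP; split => [w Ew i|w /(_ j)] /=; rewrite inE; last first.
    by rewrite eqxx; exact.
  by move=> /eqP ->; rewrite eqxx.
Qed.

Lemma cylinders_mono (J J' : pred I) : subpred J J' ->
  cylinders J `<=` cylinders J'.
Proof.
move=> JJ' E [s [f [us sJ fF ->]]]; exists s, f; split => // j /sJ.
exact: JJ'.
Qed.

Lemma sigma_cylinders_measurable J : <<s cylinders J>> `<=` measurable.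
Proof.
apply: smallest_sub; last exact: cylinders_measurable.
exact: sigma_algebra_measurable.
Qed.

Hypothesis hind : mutually_independent Pr F.

(** For a fixed event [G], the events independent of [G] form a Dynkin class, and mutual
    independence says that it contains the pi-system of cylinders. *)
Lemma sigma_cylinders_indep (J : pred I) k E G : ~~ J k ->
  <<s cylinders J>> E -> F k G -> Pr (E `&` G) = (Pr E * Pr G)%E.
Proof.
move=> Jk + FG; have mG : measurable G by exact: Fm FG.
suff : <<s cylinders J>> `<=`
    [set E | measurable E /\ Pr (E `&` G) = (Pr E * Pr G)%E].
  by move=> H /H[].
apply: lambda_system_subset; [exact: cylindersI| | |by []].
- apply/dynkin_lambda_system; split.
  + by split; rewrite // setTI probability_setT mul1e.
  + move=> X [mX XG]; split; first exact: measurableC.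
    have := probability_setC Pr mX => ->.
    rewrite muleBl ?fin_num_measure// mul1e -XG.
    have -> : ~` X `&` G = G `\` (X `&` G).
      by rewrite setDIr setDv setU0 setIC.
    rewrite measureD//; last 2 first.
      exact: measurableI.
      by rewrite ltey_eq fin_num_measure.
    by rewrite setIA [G `&` X]setIC -setIA setIid.
  + move=> X tX HX; have mX i : measurable (X i) by case: (HX i).
    split; first exact: bigcup_measurable.
    rewrite setI_bigcupl !measure_bigcup//; last 2 first.
      by move=> i _; exact: measurableI.
      exact: trivIset_setIr.
    rewrite (eq_eseriesr (g := fun i => (Pr (X i) * Pr G)%E)); last first.
      by move=> i _; case: (HX i).
    rewrite -(fineK (fin_num_measure Pr G mG)).
    under eq_eseriesr do rewrite muleC.
    by rewrite nneseriesZl// muleC.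
- move=> X CX; split; first exact: cylinders_measurable CX.
  have [s [f [us sJ fF XE]]] := CX.
  have ks : k \notin s by apply: contra Jk; exact: sJ.
  pose g j := if j == k then G else f j.
  have gF j : F j (g j) by rewrite /g; case: eqP => [->|].
  have XE' : X = \bigcap_(j in [set` s]) g j.
    rewrite XE; apply: eq_bigcapr => j /= js; rewrite /g.
    by case: eqP => // jk; rewrite -jk js in ks.
  have := hind (J := k :: s) (E := g).
  rewrite /= ks us big_cons => /(_ isT (fun j _ => gF j)).
  rewrite -(hind us (fun j _ => gF j)) -XE' {2}/g eqxx muleC => <-.
  congr (Pr _); rewrite XE'; apply/seteqP; split => [w [Xw Gw] j|w H].
    by rewrite /= inE => /predU1P[->|/Xw//]; rewrite /g eqxx.
  split=> [j js|]; first by apply: H; rewrite /= inE js orbT.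
  by have := H k; rewrite /= inE eqxx /g eqxx; exact.
Qed.

End Cylinders.

(** * Expectations of independent products *)

Section Expectation.
Context {R : realType} {d : measure_display} {Omega : measurableType d}.
Variable Pr : probability Omega R.
Implicit Types f g U V : Omega -> R.

Local Notation mean f := (\int[Pr]_w f w).

Definition rintegrable f : Prop := Pr.-integrable setT (EFin \o f).

Lemma rintegrable_measurable f : rintegrable f -> measurable_fun setT f.
Proof. by move/measurable_int/measurable_EFinP. Qed.

Lemma rintegrable_cst c : rintegrable (cst c).
Proof. exact: finite_measure_integrable_cst. Qed.

Lemma rintegrableD f g : rintegrable f -> rintegrable g ->
  rintegrable (fun w => f w + g w).
Proof. by move=> iF ig; exact: (integrableD measurableT iF ig). Qed.

Lemma rintegrableZ c f : rintegrable f -> rintegrable (fun w => c * f w).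
Proof. by move=> iF; exact: (integrableZl measurableT c iF). Qed.

Lemma rintegrable_sum (I : Type) (s : seq I) (F : I -> Omega -> R) :
  (forall i, rintegrable (F i)) -> rintegrable (fun w => \sum_(i <- s) F i w).
Proof.
move=> iF; elim: s => [|i s IH].
  by under eq_fun do rewrite big_nil; exact: (rintegrable_cst 0).
by under eq_fun do rewrite big_cons; exact: rintegrableD.
Qed.

Lemma mean_cst c : mean (cst c) = c.
Proof.
rewrite [LHS]Rintegral_cst// -[RHS]mulr1; congr (_ * _).
by have /= -> := probability_setT Pr.
Qed.

Lemma meanD f g : rintegrable f -> rintegrable g ->
  mean (fun w => f w + g w) = mean f + mean g.
Proof. by move=> iF ig; rewrite RintegralD. Qed.

Lemma meanZ c f : rintegrable f -> mean (fun w => c * f w) = c * mean f.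
Proof. by move=> iF; rewrite RintegralZl. Qed.

Lemma mean_sum (I : Type) (s : seq I) (F : I -> Omega -> R) :
  (forall i, rintegrable (F i)) ->
  mean (fun w => \sum_(i <- s) F i w) = \sum_(i <- s) mean (F i).
Proof.
move=> iF; elim: s => [|i s IH].
  rewrite big_nil; under eq_Rintegral do rewrite big_nil.
  exact: mean_cst.
rewrite big_cons; under eq_Rintegral do rewrite big_cons.
by rewrite meanD ?IH//; exact: rintegrable_sum.
Qed.

Lemma rintegrable_le f g : measurable_fun setT f ->
  {ae Pr, forall w, `|f w| <= g w} -> rintegrable g -> rintegrable f.
Proof.
move=> mf fg ig; apply/integrableP; split; first exact/measurable_EFinP.
apply: (@le_lt_trans _ _ (\int[Pr]_w `|(EFin \o g) w|)%E).
  apply: ae_ge0_le_integral => //.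
  - by apply: measurableT_comp => //; exact/measurable_EFinP.
  - by apply: measurableT_comp => //; exact: measurable_int ig.
  - apply: filterS fg => w fgw _ /=; rewrite lee_fin.
    by rewrite (le_trans fgw)// ler_norm.
by case/integrableP : ig.
Qed.

Lemma rintegrable_bounded f c : measurable_fun setT f ->
  {ae Pr, forall w, `|f w| <= c} -> rintegrable f.
Proof. by move=> mf fc; apply: rintegrable_le fc _ => //; exact: rintegrable_cst. Qed.

Lemma mean_le f g : rintegrable f -> rintegrable g ->
  {ae Pr, forall w, f w <= g w} -> mean f <= mean g.
Proof.
move=> iF ig fg.
have mf := rintegrable_measurable iF; have mg := rintegrable_measurable ig.
have mm : measurable_fun setT (fun w => Num.max (f w) (g w)).
  exact: measurable_maxr.
have E : mean (fun w => Num.max (f w) (g w)) = mean g.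
  rewrite /Rintegral; congr fine; apply: ae_eq_integral => //.
  - exact/measurable_EFinP.
  - exact/measurable_EFinP.
  - by apply: filterS fg => w /max_idPr -> _.
(* Replacing [g] by the maximum makes the inequality hold everywhere. *)
rewrite -E; apply: le_Rintegral => //.
  apply: rintegrable_le (rintegrableD (integrable_norm iF) (integrable_norm ig)) => //.
  apply: aeW => w /=; case: (leP (f w) (g w)) => _.
    by rewrite lerDr normr_ge0.
  by rewrite lerDl normr_ge0.
by move=> w _; rewrite le_max lexx.
Qed.

(** The joint law of [U] and [V] is the product of their laws, and Fubini's theorem applies. *)
Lemma mean_indepM U V : rintegrable U -> rintegrable V ->
  (forall A B, measurable A -> measurable B ->
    Pr (U @^-1` A `&` V @^-1` B) = (Pr (U @^-1` A) * Pr (V @^-1` B))%E) ->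
  rintegrable (fun w => U w * V w) /\
  mean (fun w => U w * V w) = mean U * mean V.
Proof.
move=> iU iV UV.
have mU := rintegrable_measurable iU; have mV := rintegrable_measurable iV.
pose XU : {mfun Omega >-> R} := HB.pack U (isMeasurableFun.Build _ _ _ _ U mU).
pose XV : {mfun Omega >-> R} := HB.pack V (isMeasurableFun.Build _ _ _ _ V mV).
have mW : measurable_fun setT (fun w => (U w, V w)).
  exact: measurable_fun_pair.
pose W : {mfun Omega >-> (R * R)%type} :=
  HB.pack (fun w => (U w, V w)) (isMeasurableFun.Build _ _ _ _ _ mW).
pose mu := distribution Pr XU; pose nu := distribution Pr XV.
have prodE A : measurable A -> (mu \x nu)%E A = distribution Pr W A.
  by apply: product_measure_unique => A1 A2 mA1 mA2; exact: UV.
pose f (z : R * R) : \bar R := (z.1 * z.2)%:E.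
have mf : measurable_fun setT f.
  apply/measurable_EFinP; apply: measurable_funM; [exact: measurable_fst|exact: measurable_snd].
have absU : (\int[mu]_x `|x%:E| < +oo)%E.
  rewrite ge0_integral_distribution//; last exact/measurableT_comp/measurable_EFinP.
  by case/integrableP : iU.
have absV : (\int[nu]_y `|y%:E| < +oo)%E.
  rewrite ge0_integral_distribution//; last exact/measurableT_comp/measurable_EFinP.
  by case/integrableP : iV.
have iF : (mu \x nu)%E.-integrable setT f.
  apply/integrable12ltyP => //.
  have mabs : measurable_fun setT (fun y : R => `|y|%:E).
    by apply/measurable_EFinP; exact: normr_measurable.
  rewrite (eq_integral (fun x : R => `|x|%:E * \int[nu]_y `|y|%:E)%E) => [|x _].
    have V0 : (0 <= \int[nu]_y `|y|%:E)%E by exact: integral_ge0.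
    rewrite ge0_integralZr//.
    have U0 : (0 <= \int[mu]_x `|x|%:E)%E by exact: integral_ge0.
    by apply: lte_mul_pinfty => //; rewrite ge0_fin_numE.
  rewrite -ge0_integralZl//.
  by apply: eq_integral => y _; rewrite /f /= normrM EFinM.
have iW : (distribution Pr W).-integrable setT f.
  case/integrableP : iF => _ iF; apply/integrableP; split => //.
  by rewrite (@eq_measure_integral _ _ _ _ (mu \x nu)%E)// => A mA _; exact/esym/prodE.
have iUV : rintegrable (fun w => U w * V w).
  apply/integrableP; split.
    by apply/measurable_EFinP; exact: measurable_funM.
  case/integrableP : iW => _; rewrite ge0_integral_distribution//.
  exact: measurableT_comp.
split=> //.
have muU : \int[mu]_x x = mean U.
  by rewrite /Rintegral integral_distribution//; exact/measurable_EFinP.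
have nuV : \int[nu]_x x = mean V.
  by rewrite /Rintegral integral_distribution//; exact/measurable_EFinP.
have imu : mu.-integrable setT (EFin \o id).
  by apply/integrableP; split => //; exact/measurable_EFinP.
have inu : nu.-integrable setT (EFin \o id).
  by apply/integrableP; split => //; exact/measurable_EFinP.
transitivity (fine (\int[distribution Pr W]_z f z)%E).
  by rewrite integral_distribution.
rewrite (@eq_measure_integral _ _ _ _ (mu \x nu)%E); last first.
  by move=> A mA _; exact/esym/prodE.
rewrite -integral12_prod_meas1// -muU -nuV /fubini_F.
have fV : (\int[nu]_y y%:E)%E = (\int[nu]_y y)%:E.
  by rewrite /Rintegral fineK//; exact: integrable_fin_num inu.
rewrite (eq_integral (fun x : R => x%:E * (\int[nu]_y y)%:E)%E) => [|x _].
  rewrite (integralZr measurableT imu) fineM//.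
  exact: integrable_fin_num imu.
rewrite -fV -(integralZl measurableT inu).
by apply: eq_integral => y _; rewrite /f /= EFinM.
Qed.

End Expectation.

Section SigmaOf.
Context {R : realType} {d d' : measure_display} {Omega : measurableType d}.
Context {T : measurableType d'}.
Implicit Type X : Omega -> T.

Lemma sigma_ofT X : sigma_of X setT.
Proof. by exists setT; rewrite ?setTI. Qed.

Lemma sigma_ofI X : setI_closed (sigma_of X).
Proof.
move=> _ _ [A mA <-] [B mB <-]; exists (A `&` B); first exact: measurableI.
by rewrite !setTI preimage_setI.
Qed.

Lemma sigma_of_measurable X : measurable_fun setT X ->
  sigma_of X `<=` measurable.
Proof. by move=> mX _ [A mA <-]; exact: mX. Qed.

Lemma sigma_of_comp d'' (T' : measurableType d'') X (f : T -> T') B :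
  measurable_fun setT f -> measurable B -> sigma_of X ((f \o X) @^-1` B).
Proof.
move=> mf mB; exists (f @^-1` B); last by rewrite setTI.
by rewrite -[f @^-1` B]setTI; exact: mf.
Qed.

End SigmaOf.

Section FamilyIndependence.
Context {R : realType} {d : measure_display} {Omega : measurableType d}.
Variable Pr : probability Omega R.
Context {I : eqType}.
Variable F : I -> set (set Omega).
Hypotheses (FT : forall i, F i setT) (FI : forall i, setI_closed (F i)).
Hypothesis Fm : forall i, F i `<=` measurable.
Hypothesis hind : mutually_independent Pr F.

(** [U] is a function of the members of the family with index in [J], in the sense of
    measurability for the sigma-algebra that they generate. *)
Definition depends_on (J : pred I) d' (T : measurableType d') (U : Omega -> T) :=
  @measurable_fun _ _ (g_sigma_algebraType (cylinders F J)) T setT U.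

Lemma depends_on_measurable (J : pred I) d' (T : measurableType d')
  (U : Omega -> T) : depends_on J U -> measurable_fun setT U.
Proof.
move=> mU _ B mB; rewrite setTI; apply: (sigma_cylinders_measurable Fm (J := J)).
by rewrite -[_ @^-1` _]setTI; exact: mU.
Qed.

Lemma depends_on_mono (J J' : pred I) d' (T : measurableType d')
  (U : Omega -> T) : subpred J J' -> depends_on J U -> depends_on J' U.
Proof.
move=> JJ' mU _ B mB.
have H := mU measurableT B mB.
by apply: (sub_smallest2r _ (cylinders_mono JJ')) H; exact: smallest_sigma_algebra.
Qed.

Lemma mean_depends_onM (J : pred I) k (U V : Omega -> R) : ~~ J k ->
  depends_on J U -> (forall B, measurable B -> F k (V @^-1` B)) ->
  rintegrable Pr U -> rintegrable Pr V ->
  rintegrable Pr (fun w => U w * V w) /\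
  \int[Pr]_w (U w * V w) = (\int[Pr]_w U w) * (\int[Pr]_w V w).
Proof.
move=> Jk mU FV iU iV; apply: mean_indepM => // X Y mX mY.
apply: (sigma_cylinders_indep FT FI Fm hind Jk); last exact: FV.
by rewrite -[_ @^-1` _]setTI; exact: mU.
Qed.

End FamilyIndependence.

Section DependsOn.
Context {R : realType} {d : measure_display} {Omega : measurableType d}.
Context {I : eqType}.
Variables (F : I -> set (set Omega)).

Lemma depends_on_member (FT : forall i, F i setT) (J : pred I) j d' (T : measurableType d')
  (U : Omega -> T) : J j -> (forall B, measurable B -> F j (U @^-1` B)) ->
  depends_on F J U.
Proof.
move=> Jj FU _ B mB; rewrite setTI.
by apply: sub_sigma_algebra; apply: sub_cylinders Jj _ _ => //; exact: FU.
Qed.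

Lemma depends_on_sum (J : pred I) (K : eqType) (s : seq K) (U : K -> Omega -> R) :
  {in s, forall k, depends_on F J (U k)} ->
  depends_on F J (fun w => \sum_(k <- s) U k w).
Proof.
elim: s => [_|k s IH sU].
  by under eq_fun do rewrite big_nil; exact: measurable_cst.
under eq_fun do rewrite big_cons; apply: measurable_funD.
  by apply: sU; rewrite inE eqxx.
by apply: IH => i si; apply: sU; rewrite inE si orbT.
Qed.

End DependsOn.

Section SumIndependence.
Context {R : realType} {d : measure_display} {Omega : measurableType d}.
Variable Pr : probability Omega R.
Context {I : eqType}.
Variable F : I -> set (set Omega).
Hypotheses (FT : forall i, F i setT) (FI : forall i, setI_closed (F i)).
Hypothesis Fm : forall i, F i `<=` measurable.
Hypothesis hind : mutually_independent Pr F.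

(** Averaging a polynomial in one member of the family, with coefficients that depend on other
    members, replaces each monomial by its mean. *)
Lemma mean_sum_depends_on (T : finType) (J : pred I) k (U V : T -> Omega -> R) (v : T -> R) :
  ~~ J k -> (forall t, depends_on F J (U t) /\ rintegrable Pr (U t)) ->
  (forall t B, measurable B -> F k (V t @^-1` B)) ->
  (forall t, rintegrable Pr (V t) /\ \int[Pr]_w V t w = v t) ->
  rintegrable Pr (fun w => \sum_t U t w * V t w) /\
  \int[Pr]_w (\sum_t U t w * V t w) = \int[Pr]_w (\sum_t U t w * v t).
Proof.
move=> Jk HU FV HV.
have H t : rintegrable Pr (fun w => U t w * V t w) /\
    \int[Pr]_w (U t w * V t w) = (\int[Pr]_w U t w) * v t.
  have [dU iU] := HU t; have [iV <-] := HV t.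
  exact: (mean_depends_onM FT FI Fm hind Jk dU (FV t) iU iV).
have iUv t : rintegrable Pr (fun w => U t w * v t).
  by under eq_fun do rewrite mulrC; apply: rintegrableZ; case: (HU t).
split; first by apply: rintegrable_sum => t; case: (H t).
rewrite (mean_sum (index_enum T) (fun t => (H t).1)) (mean_sum (index_enum T) iUv).
apply: eq_bigr => t _; rewrite (H t).2.
under [RHS]eq_Rintegral do rewrite mulrC.
by rewrite meanZ 1?mulrC//; case: (HU t).
Qed.

End SumIndependence.

(** * Coordinates of a standard Gaussian vector *)

Section GaussianCoordinates.
Context {R : realType} {d : measure_display} {Omega : measurableType d}.
Variables (Pr : probability Omega R) (m : nat) (y : Omega -> m.-tuple R).
Hypothesis my : measurable_fun setT y.
Hypothesis gy : standard_gaussian Pr y.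

Lemma gaussian_coord_law (j : 'I_m) (B : set R) : measurable B ->
  Pr ((fun w => tnth (y w) j) @^-1` B) = normal_prob 0 1 B.
Proof.
move=> mB; have := gy (E := fun i => if i == j then B else setT).
rewrite (bigD1 j)//= eqxx big1 ?mule1 => [|i /negbTE ->]; last first.
  exact: probability_setT.
move=> <- => [|i]; last by case: ifP.
congr (Pr _); apply/seteqP; split => [w Bw i|w /(_ j)] /=; last by rewrite eqxx.
by case: eqP => [->|].
Qed.

Lemma gaussian_coord_indep :
  mutually_independent Pr (fun j : 'I_m => sigma_of (fun w => tnth (y w) j)).
Proof.
move=> J E uJ JE.
have /choice[B HB] : forall j, exists B : set R, measurable B /\
    if j \in J then E j = (fun w => tnth (y w) j) @^-1` B else B = setT.
  move=> j; case jJ: (j \in J); last by exists setT.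
  by have [B mB <-] := JE j jJ; exists B; rewrite setTI.
have -> : \bigcap_(j in [set` J]) E j = [set w | forall j, B j (tnth (y w) j)].
  apply/seteqP; split => [w EJ j|w wB j /= jJ]; have [_] := HB j.
    by case: ifP => [jJ BE|_ ->//]; have := EJ j jJ; rewrite BE.
  by rewrite jJ => ->; exact: wB.
rewrite gy; last by move=> j; case: (HB j).
rewrite (bigID (mem J))/= [X in (_ * X)%E]big1 ?mule1 => [|j jJ]; last first.
  by have [_] := HB j; rewrite (negbTE jJ) => ->; exact: probability_setT.
rewrite -big_uniq//= [LHS]big_seq [RHS]big_seq; apply: eq_bigr => j jJ.
have [mB] := HB j; rewrite jJ => ->.
by rewrite gaussian_coord_law.
Qed.

End GaussianCoordinates.

(** * Moments of the normal law *)

Section NormalDensity.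
Context {R : realType}.
Local Notation mu := (@lebesgue_measure R).
Local Notation N01 := (normal_prob (0 : R) 1).
Local Notation pdf := (normal_pdf (0 : R) 1).

Import HBNNSimple.

Let mpdf : measurable_fun setT pdf.
Proof. exact: measurable_normal_pdf. Qed.

Let integral_normal_indic E : measurable E ->
  (\int[N01]_x (\1_E x)%:E = \int[mu]_x ((\1_E x)%:E * (pdf x)%:E))%E.
Proof.
move=> mE; rewrite integral_indic// setIT /= /normal_prob [LHS]integral_mkcond.
apply: eq_integral => x _; rewrite patchE indicE.
by case: ifP => _; rewrite ?mul1e ?mul0e.
Qed.

Let integral_normal_nnsfun (f : {nnsfun R >-> R}) :
  (\int[N01]_x (f x)%:E = \int[mu]_x ((f x)%:E * (pdf x)%:E))%E.
Proof.
have mind r : measurable_fun setT (fun x : R => (r * \1_(f @^-1` [set r]) x)%:E).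
  apply/measurable_EFinP/measurable_funM; first exact: measurable_cst.
  by apply: measurable_indic; exact: measurable_sfunP.
under [LHS]eq_integral do rewrite fimfunE -fsumEFin//.
rewrite [LHS]ge0_integral_fsum//; last first.
    by move=> n x _; rewrite EFinM nnfun_muleindic_ge0.
under [RHS]eq_integral.
  move=> x xD; rewrite muleC fimfunE -fsumEFin// ge0_mule_fsumr; last first.
    by move=> r; rewrite EFinM nnfun_muleindic_ge0.
  over.
rewrite [RHS]ge0_integral_fsum//; last 2 first.
  - move=> r; apply: emeasurable_funM; first exact/measurable_EFinP.
    exact: mind.
  - move=> n x _; rewrite EFinM mule_ge0 ?nnfun_muleindic_ge0//.
    by rewrite lee_fin normal_pdf_ge0.
apply: eq_fsbigr => r _.
under [RHS]eq_integral => x _ do rewrite EFinM muleCA.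
have mE : measurable (f @^-1` [set r]) by exact: measurable_sfunP.
under [LHS]eq_integral => x _ do rewrite EFinM.
rewrite [LHS]integralZl//; last exact: integrable_indic.
rewrite [RHS]integralZl//; last first.
  apply: (le_integrable measurableT _ _ (integrable_normal_pdf 0 1)) => [|x _].
    by apply: emeasurable_funM; apply/measurable_EFinP => //; exact: measurable_indic.
  rewrite -EFinM lee_fin normrM ler_piMr// indicE.
  by case: (_ \in _); rewrite ?normr1 ?normr0.
by rewrite integral_normal_indic//; under eq_integral do rewrite muleC.
Qed.

(** The density is given on sets, hence on indicators and simple functions; monotone
    convergence extends it to integrals. *)
Lemma integral_normal_prob (f : R -> \bar R) : measurable_fun setT f ->
  (forall x, 0 <= f x)%E ->
  (\int[N01]_x f x = \int[mu]_x (f x * (pdf x)%:E))%E.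
Proof.
move=> mf f0; pose f_ : nat -> {nnsfun R >-> R} := nnsfun_approx measurableT mf.
have mf_ n : measurable_fun setT (EFin \o f_ n).
  by apply/measurable_EFinP; exact: measurable_funPT.
have nd x i j : (i <= j)%N -> f_ i x <= f_ j x.
  by move=> ij; have /lefP := nd_nnsfun_approx measurableT mf ij; exact.
have cvgf x : (f_ n x)%:E @[n --> \oo] --> f x.
  exact: cvg_nnsfun_approx.
transitivity (lim (\int[N01]_x (f_ n x)%:E @[n --> \oo])%E).
  rewrite -monotone_convergence//=.
  - by apply: eq_integral => x _; apply/esym/cvg_lim.
  - by move=> n x _; rewrite lee_fin.
  - by move=> x _ i j ij; rewrite lee_fin nd.
rewrite [RHS](_ : _ = lim
    (\int[mu]_x ((f_ n x)%:E * (pdf x)%:E) @[n --> \oo])%E); last first.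
  rewrite -monotone_convergence//=.
  - apply: eq_integral => x _; apply/esym/cvg_lim => //.
    by apply: cvgeZr => //; exact: cvgf.
  - by move=> n; apply: emeasurable_funM; [exact: mf_|exact/measurable_EFinP].
  - by move=> n x _; apply: mule_ge0; rewrite lee_fin ?normal_pdf_ge0.
  - move=> x _ i j ij.
    by apply: lee_wpmul2r; rewrite lee_fin; [exact: normal_pdf_ge0|exact: nd].
by under eq_fun do rewrite integral_normal_nnsfun.
Qed.

End NormalDensity.

Section NormalMoments.
Context {R : realType}.
Local Notation mu := (@lebesgue_measure R).
Local Notation pdf := (normal_pdf (0 : R) 1).

Lemma normal_pdf01E x : pdf x = normal_peak 1 * expR (- (x ^+ 2 / 2)).
Proof.
rewrite normal_pdfE ?oner_eq0// /normal_fun subr0 expr1n mulNr.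
by rewrite -mulr_natl mulr1.
Qed.

Lemma is_derive_pdf (x : R) : is_derive x (1 : R) pdf (- x * pdf x).
Proof.
have -> : pdf = (fun x => normal_peak 1 * expR (- (x ^+ 2 / 2))).
  by apply/funext => y; exact: normal_pdf01E.
have D1 : is_derive x 1 (fun y : R => - (y ^+ 2 / 2)) (- x).
  by apply: is_derive_eq; rewrite /GRing.scale/=; field.
have D2 := is_derive1_comp (is_derive_expR _) D1.
by apply: is_derive_eq; rewrite /GRing.scale/=; ring.
Qed.

Lemma is_derive_exp_pdf k (x : R) : is_derive x (1 : R) (fun x : R => - (x ^+ k * pdf x))
  ((x ^+ k.+1 - k%:R * x ^+ k.-1) * pdf x).
Proof.
have D1 := is_derive_pdf x.
have D2 : is_derive x (1 : R) (fun y : R => y ^+ k) (k%:R * x ^+ k.-1).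
  have -> : (fun y : R => y ^+ k) = (id : R -> R) ^+ k by rewrite exprfctE.
  by apply: is_derive_eq; rewrite /GRing.scale/= mulr1.
apply: is_derive_eq (is_deriveN (is_deriveM D2 D1)) _.
by rewrite /GRing.scale/=; move: (x ^+ k.-1) => y; rewrite exprS; ring.
Qed.

(** The exponential of [x ^+ 2 / 4] dominates every power, which leaves the density of a Gaussian
    of larger variance. It serves both for integrability and for the boundary terms. *)
Lemma exp_pdf_dom k : exists2 C : R, 0 <= C & forall x,
  `|x ^+ k * pdf x| <= C * expR (- (x ^+ 2 / 4)).
Proof.
pose C := (1 + 4 ^+ k.+1 * (k.+1)`!%:R) * normal_peak 1 : R.
have f0 : (0 : R) < (k.+1)`!%:R by rewrite ltr0n fact_gt0.
exists C; first by rewrite mulr_ge0 ?normal_peak_ge0 ?addr_ge0 ?mulr_ge0 ?exprn_ge0 ?ltW.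
move=> x; have p0 := @normal_peak_ge0 R 1.
rewrite normrM normal_pdf01E normrM (ger0_norm p0) (ger0_norm (expR_ge0 _)).
rewrite mulrCA /C [leRHS]mulrAC [leRHS]mulrC ler_wpM2l//.
have -> : - (x ^+ 2 / 2) = - (x ^+ 2 / 4) + - (x ^+ 2 / 4) by field.
rewrite expRD mulrA ler_wpM2r ?expR_ge0// expRN ler_pdivrMr ?expR_gt0//.
have /= H := @expR_ge1Dxn R (x ^+ 2 / 4) k.
have x0 : 0 <= x ^+ 2 / 4 by rewrite divr_ge0 ?sqr_ge0.
have {}H := H x0.
have y0 : 0 <= `|x| := normr_ge0 x.
have : `|x ^+ k| <= 1 + (x ^+ 2) ^+ k.+1.
  rewrite normrX -[x ^+ 2]ger0_norm ?sqr_ge0// normrX -exprM.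
  case: (leP `|x| 1) => x1.
    by rewrite (le_trans (exprn_ile1 k y0 x1))// lerDl exprn_ge0.
  have kk : (k <= 2 * k.+1)%N by lia.
  by rewrite (le_trans (ler_weXn2l (ltW x1) kk))// lerDr.
move=> /le_trans; apply.
have e1 : 1 <= expR (x ^+ 2 / 4) by rewrite (le_trans _ (expR_ge1Dx _))// lerDl.
rewrite mulrDl mul1r lerD//.
have -> : (x ^+ 2) ^+ k.+1 = 4 ^+ k.+1 * (k.+1)`!%:R *
    ((x ^+ 2 / 4) ^+ k.+1 / (k.+1)`!%:R).
  by rewrite expr_div_n; field; rewrite gt_eqF//= expf_neq0.
rewrite ler_wpM2l ?mulr_ge0 ?exprn_ge0 ?(ltW f0)//.
by apply: le_trans H; rewrite lerDr.
Qed.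

Lemma measurable_exp_pdf k : measurable_fun setT (fun x : R => x ^+ k * pdf x).
Proof.
by apply: measurable_funM; [exact: measurable_funX|exact: measurable_normal_pdf].
Qed.

Lemma integrable_exp_pdf k :
  mu.-integrable setT (EFin \o (fun x : R => x ^+ k * pdf x)).
Proof.
have [C C0 HC] := exp_pdf_dom k.
pose s : R := Num.sqrt 2.
have s0 : s != 0 by rewrite gt_eqF// sqrtr_gt0.
pose p := normal_peak s; have p0 : 0 < p by exact: normal_peak_gt0.
have i2 := integrableZl measurableT (C / p) (integrable_normal_pdf (0 : R) s).
apply: (le_integrable measurableT _ _ i2) => [|x _].
  by apply/measurable_EFinP; exact: measurable_exp_pdf.
rewrite /= lee_fin (le_trans (HC x))// ger0_norm; last first.
  by rewrite mulr_ge0 ?normal_pdf_ge0// divr_ge0// ltW.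
rewrite normal_pdfE// /normal_fun subr0 sqr_sqrtr// -/p.
rewrite mulrA divfK ?gt_eqF// le_eqVlt; apply/orP; left; apply/eqP.
by congr (_ * expR _); rewrite -mulr_natl; field.
Qed.

(** Stein's identity for monomials: [x ^+ k.+1 - k%:R * x ^+ k.-1] times the density is the
    derivative of a function vanishing at infinity. *)
Lemma normal_pdf_stein k : \int[mu]_x (x ^+ k.+1 * pdf x) =
  k%:R * \int[mu]_x (x ^+ k.-1 * pdf x).
Proof.
pose F (x : R) := - (x ^+ k * pdf x).
pose f (x : R) := (x ^+ k.+1 - k%:R * x ^+ k.-1) * pdf x.
have fE x : f x = x ^+ k.+1 * pdf x - k%:R * (x ^+ k.-1 * pdf x).
  by rewrite /f; ring.
have iF : mu.-integrable setT (EFin \o f).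
  have -> : EFin \o f = (fun x => (x ^+ k.+1 * pdf x)%:E - k%:R%:E * (x ^+ k.-1 * pdf x)%:E)%E.
    by apply/funext => x /=; rewrite fE.
  exact: (integrableB measurableT (integrable_exp_pdf k.+1)
    (integrableZl measurableT k%:R (integrable_exp_pdf k.-1))).
suff f0 : \int[mu]_x f x = 0.
  move/eqP: f0; under eq_Rintegral do rewrite fE.
  have i1 := integrable_exp_pdf k.+1; have i2 := integrable_exp_pdf k.-1.
  have i3 := integrableZl measurableT k%:R i2.
  by rewrite (RintegralB measurableT i1 i3) (RintegralZl _ measurableT i2) subr_eq0 => /eqP.
have mf : measurable_fun setT f by move/measurable_int/measurable_EFinP: iF.
pose f_ n := (EFin \o f) \_ `[- n.+1%:R, n.+1%:R]%classic.
have dF x : derivable F x 1 by have [] := is_derive_exp_pdf k x.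
have cF : continuous F.
  by move=> x; apply/differentiable_continuous/derivable1_diffP.
have cpow j : continuous (fun x : R => x ^+ j) by exact: exprn_continuous.
have cf : continuous f.
  move=> x; apply: cvgM; last by apply: continuous_normal_pdf; exact: oner_neq0.
  apply: (@cvgB _ R^o); first exact: cpow.
  by apply: cvgM; [exact: cvg_cst|exact: cpow].
have int_n n : (\int[mu]_x f_ n x = (F n.+1%:R - F (- n.+1%:R))%:E)%E.
  rewrite -integral_mkcond (@continuous_FTC2 _ f F) ?EFinB//.
  - by rewrite -subr_gt0 opprK addr_gt0.
  - exact: continuous_subspaceT.
  - split=> [x _||]; first exact: dF.
      exact/cvg_at_right_filter/cF.
    exact/cvg_at_left_filter/cF.
  - by move=> x _; rewrite derive1E; apply: derive_val; exact: is_derive_exp_pdf.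
have lim1 : (\int[mu]_x f_ n x)%E @[n --> \oo] --> (\int[mu]_x (f x)%:E)%E.
  have mf_ n : measurable_fun setT (f_ n).
    by apply/(measurable_restrictT _ _).1 => //; exact/measurable_EFinP/measurable_funTS.
  have f_le n x : (`|f_ n x| <= `|(f x)%:E|)%E.
    by rewrite /f_ patchE; case: ifP => _ //; rewrite abse0.
  have f_cvg x : f_ n x @[n --> \oo] --> (f x)%:E.
    apply: cvg_near_cst; exists (Num.bound `|x|) => //= n xn.
    rewrite /f_ patchE mem_set//= in_itv /= -ler_norml.
    rewrite (le_trans (ltW (archi_boundP (normr_ge0 x))))// ler_nat.
    exact: leqW.
  have ae_cvg : {ae mu, forall x, setT x -> f_ ^~ x @ \oo --> (EFin \o f) x}.
    by apply: aeW => x _; exact: f_cvg.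
  have ae_le : {ae mu, forall x n, setT x -> (`|f_ n x| <= (abse \o (EFin \o f)) x)%E}.
    by apply: aeW => x n _; exact: f_le.
  by have [_ _] := @dominated_convergence _ _ _ mu setT measurableT f_ (EFin \o f)
    (abse \o (EFin \o f)) mf_ (measurable_int _ iF) ae_cvg (integrable_abse iF) ae_le.
have lim2 : (\int[mu]_x f_ n x)%E @[n --> \oo] --> 0%:E.
  under eq_fun do rewrite int_n.
  apply: cvg_EFin; first exact: nearW.
  have [C C0 HC] := exp_pdf_dom k.
  have e_le (y : R) : expR (- (y ^+ 2 / 4)) <= expR (1 - y).
    rewrite ler_expR -subr_ge0.
    have -> : 1 - y - - (y ^+ 2 / 4) = (y / 2 - 1) ^+ 2 by field.
    exact: sqr_ge0.
  have F_le n : `|F n.+1%:R - F (- n.+1%:R)| <= C * 2 * expR (- n%:R).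
    have nE : 1 - n.+1%:R = - n%:R :> R by rewrite -natr1; ring.
    rewrite (le_trans (ler_normB _ _))// /F !normrN.
    rewrite -mulrA mulr_natl mulr2n mulrDr lerD// (le_trans (HC _))//.
      by rewrite ler_wpM2l// (le_trans (e_le _))// nE.
    by rewrite sqrrN ler_wpM2l// (le_trans (e_le _))// nE.
  have lim_e : C * 2 * expR (- n%:R) @[n --> \oo] --> 0.
    rewrite -[X in _ --> X](mulr0 (C * 2)); apply: cvgM; first exact: cvg_cst.
    exact: cvgn_expR.
  apply: norm_cvg0; apply: (squeeze_cvgr _ (cvg_cst 0) lim_e).
  by apply: nearW => n /=; rewrite normr_ge0 F_le.
by rewrite /Rintegral (cvg_unique _ lim1 lim2).
Qed.

End NormalMoments.

Section NormalVariable.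
Context {R : realType} {d : measure_display} {Omega : measurableType d}.
Variables (Pr : probability Omega R) (V : Omega -> R).
Hypothesis mV : measurable_fun setT V.
Hypothesis lawV : forall B, measurable B -> Pr (V @^-1` B) = normal_prob 0 1 B.

Local Notation mu := (@lebesgue_measure R).
Local Notation pdf := (normal_pdf (0 : R) 1).

Lemma ge0_integral_normal (f : R -> R) : measurable_fun setT f ->
  (forall x, 0 <= f x) ->
  (\int[Pr]_w (f (V w))%:E = \int[mu]_x (f x * pdf x)%:E)%E.
Proof.
move=> mf f0.
have mV' : @measurable_fun _ _ Omega (measurableTypeR R) setT V by exact: mV.
pose X : {mfun Omega >-> measurableTypeR R} :=
  HB.pack V (isMeasurableFun.Build _ ((R.-ocitv.-measurable).-sigma)%mdisp _
    (measurableTypeR R) V mV').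
have mfE : measurable_fun setT (EFin \o f) by exact/measurable_EFinP.
transitivity (\int[distribution Pr X]_x (f x)%:E)%E.
  by rewrite ge0_integral_distribution// => x; rewrite lee_fin.
transitivity (\int[normal_prob (0 : R) 1]_x (f x)%:E)%E.
  by apply: eq_measure_integral => B mB _; exact: lawV.
by rewrite integral_normal_prob// => x; rewrite lee_fin.
Qed.

Lemma rintegrable_normalX k : rintegrable Pr (fun w => V w ^+ k).
Proof.
apply/integrableP; split.
  by apply/measurable_EFinP; exact: measurable_funX.
have mf : measurable_fun setT (fun x : R => `|x ^+ k|).
  by apply: measurableT_comp => //; exact: measurable_funX.
rewrite (ge0_integral_normal mf) => [|x]; last exact: normr_ge0.
have /integrableP[_] := @integrable_exp_pdf R k.
apply: le_lt_trans; apply: ge0_le_integral => //=.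
- by move=> x _; rewrite lee_fin mulr_ge0 ?normal_pdf_ge0.
- by apply/measurable_EFinP/measurable_funM => //; exact: measurable_normal_pdf.
- by apply/measurable_EFinP; apply: measurableT_comp => //; exact: measurable_exp_pdf.
- by move=> x _; rewrite lee_fin normrM (ger0_norm (normal_pdf_ge0 _ _ _)).
Qed.

(** A power is the difference of the nonnegative functions [`|x ^+ k| + x ^+ k] and
    [`|x ^+ k|], to which the change of variables for nonnegative functions applies. *)
Lemma mean_normalX k :
  \int[Pr]_w (V w ^+ k) = \int[mu]_x (x ^+ k * pdf x).
Proof.
have mX : measurable_fun setT (fun x : R => x ^+ k) by exact: measurable_funX.
have mf : measurable_fun setT (fun x : R => `|x ^+ k|) by exact: measurableT_comp.
have mg : measurable_fun setT (fun x : R => `|x ^+ k| + x ^+ k) by exact: measurable_funD.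
have f0 (x : R) : 0 <= `|x ^+ k| by [].
have g0 (x : R) : 0 <= `|x ^+ k| + x ^+ k by have := ler_norm (- x ^+ k); rewrite normrN; lra.
have iX := rintegrable_normalX k.
have iN : rintegrable Pr (fun w => `|V w ^+ k|) := integrable_norm iX.
have E1 := congr1 fine (ge0_integral_normal mf f0).
have E2 := congr1 fine (ge0_integral_normal mg g0).
have ip := @integrable_exp_pdf R k.
have ipn : mu.-integrable setT (EFin \o (fun x : R => `|x ^+ k| * pdf x)).
  have := integrable_norm ip; apply: eq_integrable => // x _ /=.
  by rewrite normrM (ger0_norm (normal_pdf_ge0 _ _ _)).
have S1 : \int[Pr]_w (`|V w ^+ k| + V w ^+ k) =
  \int[Pr]_w `|V w ^+ k| + \int[Pr]_w (V w ^+ k) by exact: meanD.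
have S2 : \int[mu]_x ((`|x ^+ k| + x ^+ k) * pdf x) =
  \int[mu]_x (`|x ^+ k| * pdf x) + \int[mu]_x (x ^+ k * pdf x).
  by rewrite -(RintegralD measurableT ipn ip); apply: eq_Rintegral => x _; rewrite mulrDl.
move: S1; rewrite {1}/Rintegral E2 -/(Rintegral _ _ _) S2.
by rewrite [X in _ = X + _]/Rintegral E1 => /addrI.
Qed.

Lemma mean_normal_stein k : \int[Pr]_w (V w ^+ k.+1) = k%:R * \int[Pr]_w (V w ^+ k.-1).
Proof. by rewrite !mean_normalX normal_pdf_stein. Qed.

Lemma mean_normal0 : \int[Pr]_w (V w ^+ 0) = 1.
Proof. exact: (mean_cst Pr 1). Qed.

Lemma mean_normal_moments : [/\ \int[Pr]_w (V w ^+ 1) = 0,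
  \int[Pr]_w (V w ^+ 2) = 1, \int[Pr]_w (V w ^+ 3) = 0,
  \int[Pr]_w (V w ^+ 4) = 3 & \int[Pr]_w (V w ^+ 6) = 15].
Proof.
have E0 := mean_normal0.
have E1 : \int[Pr]_w (V w ^+ 1) = 0 by rewrite mean_normal_stein mul0r.
have E2 : \int[Pr]_w (V w ^+ 2) = 1 by rewrite mean_normal_stein E0 mulr1.
have E3 : \int[Pr]_w (V w ^+ 3) = 0 by rewrite mean_normal_stein E1 mulr0.
have E4 : \int[Pr]_w (V w ^+ 4) = 3 by rewrite mean_normal_stein E2 mulr1.
by split => //; rewrite mean_normal_stein E4; ring.
Qed.

End NormalVariable.

(** * Moments of a standard Gaussian vector *)

Section GaussianVector.
Context {R : realType} {d : measure_display} {Omega : measurableType d}.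
Variables (Pr : probability Omega R) (m : nat) (y : Omega -> m.-tuple R).
Hypothesis my : measurable_fun setT y.
Hypothesis gy : standard_gaussian Pr y.

Local Notation c j w := (tnth (y w) j).
Let F (j : 'I_m) := sigma_of (fun w => c j w).

Let mc j : measurable_fun setT (fun w => c j w).
Proof. exact: (measurableT_comp (f := fun t : m.-tuple R => tnth t j) (measurable_tnth j) my). Qed.

Let FT j : F j setT. Proof. exact: sigma_ofT. Qed.
Let FI j : setI_closed (F j). Proof. exact: sigma_ofI. Qed.
Let Fm j : F j `<=` measurable. Proof. exact: sigma_of_measurable. Qed.
Let hind : mutually_independent Pr F. Proof. exact: gaussian_coord_indep. Qed.

Let coordX j k B : measurable B -> F j ((fun w => c j w ^+ k) @^-1` B).
Proof.
move=> mB; have mX := measurable_funX k (@measurable_id _ R setT).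
exact: (sigma_of_comp (fun w => c j w) mX mB).
Qed.

Let lawc j B : measurable B -> Pr ((fun w => c j w) @^-1` B) = normal_prob 0 1 B.
Proof. exact: gaussian_coord_law. Qed.

Let icX j k : rintegrable Pr (fun w => c j w ^+ k).
Proof. exact: (rintegrable_normalX (mc j) (@lawc j)). Qed.

Let moments j := mean_normal_moments (mc j) (@lawc j).

Let indepM (J : pred 'I_m) U j k : ~~ J j -> depends_on F J U -> rintegrable Pr U ->
  rintegrable Pr (fun w => U w * c j w ^+ k) /\
  \int[Pr]_w (U w * c j w ^+ k) = \int[Pr]_w U w * \int[Pr]_w (c j w ^+ k).
Proof.
move=> Jj dU iU; apply: (mean_depends_onM FT FI Fm hind Jj dU) => //.
exact: coordX.
Qed.

Let depX (J : pred 'I_m) j k : J j -> depends_on F J (fun w => c j w ^+ k).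
Proof. by move=> Jj; apply: (depends_on_member FT Jj); exact: coordX. Qed.

Lemma gaussian_mean1 j : rintegrable Pr (fun w => c j w) /\ \int[Pr]_w c j w = 0.
Proof.
have E : (fun w => c j w) = (fun w => c j w ^+ 1) by apply/funext => w; rewrite expr1.
by rewrite E; split; [exact: icX|case: (moments j)].
Qed.

Lemma gaussian_mean2 j k : rintegrable Pr (fun w => c j w * c k w) /\
  \int[Pr]_w (c j w * c k w) = (j == k)%:R.
Proof.
have [<-|jk] := eqVneq j k.
  have E : (fun w => c j w * c j w) = (fun w => c j w ^+ 2) by apply/funext => w; rewrite expr2.
  by rewrite E; split; [exact: icX|case: (moments j)].
have [i1 e1] := gaussian_mean1 j; have [i2 e2] := gaussian_mean1 k.
have jk' : ~~ pred1 j k by rewrite /= eq_sym.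
have := indepM 1 jk' (depX 1 (eqxx j : pred1 j j)) (icX j 1).
under eq_fun do rewrite !expr1.
by case: (moments j) => -> _ _ _ _; rewrite mul0r.
Qed.

Lemma gaussian_mean3 j k l : rintegrable Pr (fun w => c j w * c k w * c l w) /\
  \int[Pr]_w (c j w * c k w * c l w) = 0.
Proof.
(* A coordinate different from the two others factors out with its zero mean. *)
have out a b e : a != e -> b != e ->
    rintegrable Pr (fun w => c a w * c b w * c e w) /\
    \int[Pr]_w (c a w * c b w * c e w) = 0.
  move=> ae be; have [iab _] := gaussian_mean2 a b.
  pose J : pred 'I_m := fun i => i != e.
  have dep i : J i -> depends_on F J (fun w => c i w).
    by move=> Ji; have := depX 1 Ji; under eq_fun do rewrite expr1.
  have Je : ~~ J e by rewrite /J eqxx.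
  have dab : depends_on F J (fun w => c a w * c b w).
    by apply: measurable_funM; exact: dep.
  have := indepM 1 Je dab iab.
  under eq_fun do rewrite expr1.
  by case: (moments e) => -> _ _ _ _; rewrite mulr0.
have [jl|jl] := eqVneq j l; have [kl|kl] := eqVneq k l; last exact: out.
- subst k l; have E : (fun w => c j w * c j w * c j w) = (fun w => c j w ^+ 3).
    by apply/funext => w; ring.
  by rewrite E; split; [exact: icX|case: (moments j)].
- subst l; have jk : j != k by rewrite eq_sym.
  have E : (fun w => c j w * c k w * c j w) = (fun w => c j w * c j w * c k w).
    by apply/funext => w; ring.
  by rewrite E; exact: out.
- subst l; have kj : k != j by rewrite eq_sym.
  have E : (fun w => c j w * c k w * c k w) = (fun w => c k w * c k w * c j w).
    by apply/funext => w; ring.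
  by rewrite E; exact: out.
Qed.

(** The moments of the chi-squared distribution, by adding one coordinate at a time. *)
Lemma gaussian_sqnorm_moments : let S w := \sum_j c j w ^+ 2 in
  [/\ rintegrable Pr (fun w => S w ^+ 1), rintegrable Pr (fun w => S w ^+ 2),
      rintegrable Pr (fun w => S w ^+ 3) &
  [/\ \int[Pr]_w (S w ^+ 1) = m%:R, \int[Pr]_w (S w ^+ 2) = m%:R * (m%:R + 2) &
      \int[Pr]_w (S w ^+ 3) = m%:R * (m%:R + 2) * (m%:R + 4)]].
Proof.
pose P k (S : Omega -> R) :=
  [/\ rintegrable Pr (fun w => S w ^+ 1), rintegrable Pr (fun w => S w ^+ 2),
      rintegrable Pr (fun w => S w ^+ 3) &
  [/\ \int[Pr]_w (S w ^+ 1) = k%:R, \int[Pr]_w (S w ^+ 2) = k%:R * (k%:R + 2) &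
      \int[Pr]_w (S w ^+ 3) = k%:R * (k%:R + 2) * (k%:R + 4)]].
suff H (s : seq 'I_m) : uniq s -> P (size s) (fun w => \sum_(j <- s) c j w ^+ 2).
  have := H _ (index_enum_uniq 'I_m); rewrite /P.
  by rewrite /index_enum -enumT size_enum_ord.
elim: s => [_|j s IH /=/andP[js us]].
  have E n : (fun w => (\sum_(j <- [::]) c j w ^+ 2) ^+ n.+1) = cst 0 :> (Omega -> R).
    by apply/funext => w; rewrite big_nil expr0n.
  rewrite /P (E 0%N) (E 1%N) (E 2%N) /= !(mean_cst Pr 0) !mul0r.
  by split=> //; exact: rintegrable_cst.
have [i1 i2 i3 [e1 e2 e3]] := IH us.
set S := fun w => \sum_(j <- s) c j w ^+ 2 in i1 i2 i3 e1 e2 e3.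
have dS : depends_on F (mem s) S.
  by apply: depends_on_sum => i si; exact: depX.
have dSX n : depends_on F (mem s) (fun w => S w ^+ n) by exact: measurable_funX.
have js' : ~~ mem s j by [].
have [_ m2 _ m4 m6] := moments j.
have [j1 f1] := indepM 2 js' (dSX 1%N) i1.
have [j2 f2] := indepM 4 js' (dSX 1%N) i1.
have [j3 f3] := indepM 2 js' (dSX 2%N) i2.
have E1 : (fun w => (\sum_(i <- j :: s) c i w ^+ 2) ^+ 1) = (fun w => S w ^+ 1 + c j w ^+ 2).
  by apply/funext => w; rewrite big_cons /S; ring.
have E2 : (fun w => (\sum_(i <- j :: s) c i w ^+ 2) ^+ 2) =
    (fun w => S w ^+ 2 + (2 * (S w ^+ 1 * c j w ^+ 2) + c j w ^+ 4)).
  by apply/funext => w; rewrite big_cons /S; ring.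
have E3 : (fun w => (\sum_(i <- j :: s) c i w ^+ 2) ^+ 3) =
    (fun w => S w ^+ 3 + (3 * (S w ^+ 2 * c j w ^+ 2) +
      (3 * (S w ^+ 1 * c j w ^+ 4) + c j w ^+ 6))).
  by apply/funext => w; rewrite big_cons /S; ring.
have k1 := rintegrableZ 2 j1; have k3 := rintegrableZ 3 j3; have k2 := rintegrableZ 3 j2.
have l1 := rintegrableD k1 (icX j 4).
have l2 := rintegrableD k2 (icX j 6); have l3 := rintegrableD k3 l2.
rewrite /P E1 E2 E3; split; do ?exact: rintegrableD; split.
- by rewrite meanD// e1 m2 -natr1.
- by rewrite !meanD// meanZ// f1 e2 e1 m2 m4 -natr1; ring.
- by rewrite !meanD// !meanZ// f2 f3 e3 e2 e1 m2 m4 m6 -natr1; ring.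
Qed.

End GaussianVector.

(** * Algebras of functions containing the iterates *)

Section FunctionAlgebra.
Context {R : realType} {T : Type}.

(** A class of functions containing the constants and closed under sums and products: it is
    then closed under all the matrix operations that define the iterates. *)
Definition function_algebra (C : (T -> R) -> Prop) : Prop :=
  [/\ forall c, C (cst c), forall f g, C f -> C g -> C (fun w => f w + g w) &
      forall f g, C f -> C g -> C (fun w => f w * g w)].

Variable C : (T -> R) -> Prop.
Hypothesis HC : function_algebra C.

Definition mx_in p q (X : T -> 'M[R]_(p, q)) : Prop :=
  forall a b, C (fun w => X w a b).

Lemma algebra_sum (I : Type) (s : seq I) (f : I -> T -> R) :
  (forall i, C (f i)) -> C (fun w => \sum_(i <- s) f i w).
Proof.
have [C0 CD _] := HC; move=> fC; elim: s => [|i s IH].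
  by under eq_fun do rewrite big_nil; exact: C0.
by under eq_fun do rewrite big_cons; exact: CD.
Qed.

Lemma mx_in_cst p q (X : 'M[R]_(p, q)) : mx_in (fun=> X).
Proof. by case: HC => C0 _ _ a b; exact: C0. Qed.

Lemma mx_inD p q (X Y : T -> 'M[R]_(p, q)) :
  mx_in X -> mx_in Y -> mx_in (fun w => X w + Y w).
Proof.
case: HC => _ CD _ mX mY a b; under eq_fun do rewrite mxE; exact: CD.
Qed.

Lemma mx_inZ p q c (X : T -> 'M[R]_(p, q)) :
  C c -> mx_in X -> mx_in (fun w => c w *: X w).
Proof.
case: HC => _ _ CM mc mX a b; under eq_fun do rewrite mxE; exact: CM.
Qed.

Lemma mx_inN p q (X : T -> 'M[R]_(p, q)) : mx_in X -> mx_in (fun w => - X w).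
Proof.
move=> mX; under eq_fun do rewrite -scaleN1r.
by apply: mx_inZ mX; case: HC => C0 _ _; exact: C0.
Qed.

Lemma mx_inB p q (X Y : T -> 'M[R]_(p, q)) :
  mx_in X -> mx_in Y -> mx_in (fun w => X w - Y w).
Proof. by move=> mX mY; apply: mx_inD => //; exact: mx_inN. Qed.

Lemma mx_in_tr p q (X : T -> 'M[R]_(p, q)) : mx_in X -> mx_in (fun w => (X w)^T).
Proof. by move=> mX a b; under eq_fun do rewrite mxE; exact: mX. Qed.

Lemma mx_inM p q r (X : T -> 'M[R]_(p, q)) (Y : T -> 'M[R]_(q, r)) :
  mx_in X -> mx_in Y -> mx_in (fun w => X w *m Y w).
Proof.
case: HC => _ _ CM mX mY a b; under eq_fun do rewrite mxE.
by apply: algebra_sum => i; exact: CM.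
Qed.

Lemma algebra_frob_dot p q (X Y : T -> 'M[R]_(p, q)) :
  mx_in X -> mx_in Y -> C (fun w => frob_dot (X w) (Y w)).
Proof.
case: HC => _ _ CM mX mY.
by apply: algebra_sum => a; apply: algebra_sum => b; exact: CM.
Qed.

Lemma algebra_qform n (M : T -> 'M[R]_n) (z : T -> 'cV[R]_n) :
  mx_in M -> mx_in z -> C (fun w => qform (M w) (z w)).
Proof.
move=> mM mz; have H := mx_inM (mx_inM (mx_in_tr mz) mM) mz.
exact: H.
Qed.

Section Iterates.
Context {n m : nat}.
Variables (A : 'M[R]_n) (B : 'M[R]_(n, m)) (Q : 'M[R]_n) (Ru : 'M[R]_m).
Variables (P : 'M[R]_n) (sigma : R) (alpha : nat -> R).

Lemma algebra_Qfun (x : T -> 'cV[R]_n) (u : T -> 'cV[R]_m) :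
  mx_in x -> mx_in u -> C (fun w => Qfun A B Q Ru P (x w) (u w)).
Proof.
move=> mx mu; have [C0 CD CM] := HC.
have mxu : mx_in (fun w => A *m x w + B *m u w).
  by apply: mx_inD; apply: mx_inM => //; exact: mx_in_cst.
by apply: (CD _ _ _ _); [apply: CD|]; apply: algebra_qform => //; exact: mx_in_cst.
Qed.

Lemma mx_in_grad_estimate (K : T -> 'M[R]_(m, n)) x eta :
  mx_in K -> mx_in x -> mx_in eta ->
  mx_in (fun w => grad_estimate A B Q Ru P sigma (K w) (x w) (eta w)).
Proof.
move=> mK mx me; have [C0 CD CM] := HC.
apply: mx_inN; apply: mx_inZ; last by apply: mx_inM => //; exact: mx_in_tr.
apply: CM; first exact: C0.
apply: algebra_Qfun => //; apply: mx_inD; first by apply: mx_inN; exact: mx_inM.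
by apply: mx_inZ => //; exact: C0.
Qed.

Lemma mx_in_pg_iterate (x : nat -> T -> 'cV[R]_n) (eta : nat -> T -> 'cV[R]_m) K0 i :
  (forall j, (j < i)%N -> mx_in (x j) /\ mx_in (eta j)) ->
  mx_in (fun w => pg_iterate A B Q Ru P sigma alpha
    (fun j => x j w) (fun j => eta j w) K0 i).
Proof.
elim: i => [_|i IH H] /=; first exact: mx_in_cst.
have {}IH := IH (fun j ji => H j (ltnW ji)).
have [mx me] := H i (ltnSn i).
apply: mx_inB => //; apply: mx_inZ; first by case: HC => C0 _ _; exact: C0.
exact: mx_in_grad_estimate.
Qed.

End Iterates.
End FunctionAlgebra.

(** * The sampled cost and the initial state *)

Section SampleCost.
Context {R : realType} {n m : nat}.
Variables (A : 'M[R]_n) (B : 'M[R]_(n, m)) (Q : 'M[R]_n) (Ru : 'M[R]_m).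
Variable P : 'M[R]_n.
Hypotheses (sRu : Ru^T = Ru) (sP : P^T = P).

(** The sampled cost is quadratic in the exploration [v] around the feedback control, and the
    linear coefficient is the Bellman residual, half the quantity that the estimate is after. *)
Lemma Qfun_expand K (x : 'cV[R]_n) (v : 'cV[R]_m) :
  Qfun A B Q Ru P x (- (K *m x) + v) = Qfun A B Q Ru P x (- (K *m x))
    - 2 * frob_dot v (bellman_resid A B Ru P K *m x) + qform (ctrl_hess B Ru P) v.
Proof.
rewrite /Qfun mulmxDr addrA !qform_addv//.
rewrite qformD qform_congr; set u := - (K *m x).
have -> : bellman_resid A B Ru P K *m x =
    - (Ru *m u + B^T *m (P *m (A *m x + B *m u))).
  rewrite /bellman_resid /ctrl_hess /u !mulmxBl !mulmxDl !mulmxDr !mulmxN !mulmxA.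
  by apply/matrixP => a b; rewrite !mxE; ring.
rewrite frob_dotNr frob_dotDr -[frob_dot v (B^T *m _)]frob_dot_mulmxl.
have -> : frob_dot (A *m x + B *m u) (P *m (B *m v))
    = frob_dot (B *m v) (P *m (A *m x + B *m u)).
  by rewrite frob_dotC frob_dot_mulmxl sP.
by rewrite [frob_dot u (Ru *m v)]frob_dotC frob_dot_mulmxl sRu !mulmxDr !frob_dotlin; ring.
Qed.

End SampleCost.

Lemma measurable_algebra {R : realType} d (T : measurableType d) :
  function_algebra (fun f : T -> R => measurable_fun setT f).
Proof.
by split=> [c|f g|f g]; [exact: measurable_cst|exact: measurable_funD|exact: measurable_funM].
Qed.

Lemma measurable_colv {R : realType} n :
  mx_in (fun f : n.-tuple R -> R => measurable_fun setT f) (@colv R n).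
Proof. by move=> i j; under eq_fun do rewrite mxE; exact: measurable_tnth. Qed.

Section InitialState.
Context {R : realType} {n : nat}.
Variables (D : probability (n.-tuple R) R) (Sigma0 : 'M[R]_n) (Cm : R).
Hypothesis hcov : forall i j, \int[D]_x (colv x *m (colv x)^T) i j = Sigma0 i j.
Hypothesis hbound : {ae D, forall x, frob_norm (colv x) ^+ 2 <= Cm}.

Lemma colv_mulT (x : 'cV[R]_n) i j : (x *m x^T) i j = x i 0 * x j 0.
Proof. by rewrite mxE big_ord1 mxE. Qed.

Lemma colv_prod_le (x : 'cV[R]_n) i j : `|x i 0 * x j 0| <= frob_dot x x.
Proof.
have sq k : x k 0 ^+ 2 <= frob_dot x x.
  rewrite /frob_dot (bigD1 k)//= big_ord1 -expr2 lerDl sumr_ge0// => l _.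
  by rewrite big_ord1 -expr2 sqr_ge0.
have := sq i; have := sq j; rewrite normrM -(real_normK (num_real (x i 0))).
rewrite -(real_normK (num_real (x j 0))).
have := sqr_ge0 (`|x i 0| - `|x j 0|); nra.
Qed.

Lemma integrable_state_prod i j :
  rintegrable D (fun x => colv x i 0 * colv x j 0).
Proof.
apply: (rintegrable_bounded (c := Cm)).
  by apply: measurable_funM; exact: measurable_colv.
apply: filterS hbound => x; apply: le_trans.
by rewrite sqr_frob_norm colv_prod_le.
Qed.

Lemma mean_state_prod i j : \int[D]_x (colv x i 0 * colv x j 0) = Sigma0 i j.
Proof. by rewrite -hcov; apply: eq_Rintegral => x _; rewrite colv_mulT. Qed.

Lemma qform_sum (M : 'M[R]_n) (x : 'cV[R]_n) :
  qform M x = \sum_(k : 'I_n * 'I_n) M k.1 k.2 * (x k.1 0 * x k.2 0).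
Proof.
rewrite -(pair_big xpredT xpredT (fun i j => M i j * (x i 0 * x j 0)))/=.
rewrite qformE; apply: eq_bigr => i _; rewrite big_ord1 mxE mulr_sumr.
by apply: eq_bigr => j _; ring.
Qed.

Lemma mean_qform (M : 'M[R]_n) : \int[D]_x qform M (colv x) = frob_dot M Sigma0.
Proof.
under eq_Rintegral do rewrite qform_sum.
rewrite (mean_sum (index_enum _) (fun k => rintegrableZ _ (integrable_state_prod k.1 k.2))).
rewrite /frob_dot pair_big /=; apply: eq_bigr => k _.
by rewrite (meanZ _ (integrable_state_prod k.1 k.2)) mean_state_prod.
Qed.

Lemma trace_mono (M : 'M[R]_n) :
  (forall z, 0 <= qform M z) -> 0 <= frob_dot M Sigma0.
Proof. by move=> M0; rewrite -mean_qform; apply: Rintegral_ge0 => x _. Qed.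

Lemma surrogate_costE m (A : 'M[R]_n) (B : 'M[R]_(n, m)) Q (Ru : 'M[R]_m) P K :
  surrogate_cost A B Q Ru D P K = trace_cost A B Q Ru P Sigma0 K.
Proof.
rewrite /surrogate_cost mean_qform /trace_cost /policy_op; congr (frob_dot _ _).
by rewrite -addrA addrC; congr (_ + _); rewrite addrC.
Qed.

Context {d : measure_display} {Omega : measurableType d}.
Variables (Pr : probability Omega R) (X : {RV Pr >-> (n.-tuple R)%type}).
Hypothesis hX : forall E, measurable E -> distribution Pr X E = D E.

Lemma ae_state (S : set (n.-tuple R)) : {ae D, forall x, S x} ->
  {ae Pr, forall w, S (X w)}.
Proof.
move=> [N [mN N0 SN]]; exists (X @^-1` N); split.
- by rewrite -[_ @^-1` _]setTI; exact: measurable_funPT.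
- by rewrite -[RHS]N0 -hX.
- by move=> w /= Sw; apply: SN.
Qed.

Lemma state_prod i j : rintegrable Pr (fun w => colv (X w) i 0 * colv (X w) j 0) /\
  \int[Pr]_w (colv (X w) i 0 * colv (X w) j 0) = Sigma0 i j.
Proof.
have mf : measurable_fun setT (fun x : n.-tuple R => colv x i 0 * colv x j 0).
  by apply: measurable_funM; exact: measurable_colv.
have iX : rintegrable Pr (fun w => colv (X w) i 0 * colv (X w) j 0).
  apply: (rintegrable_bounded (c := Cm)).
    exact: (measurableT_comp mf (measurable_funPT X)).
  apply: filterS (ae_state hbound) => w; apply: le_trans.
  by rewrite sqr_frob_norm colv_prod_le.
split=> //; rewrite -mean_state_prod.
have mfE : measurable_fun setT (EFin \o (fun x : n.-tuple R => colv x i 0 * colv x j 0)).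
  exact/measurable_EFinP.
have := integral_distribution mfE iX; rewrite /Rintegral => <-.
congr fine; apply: eq_measure_integral => E mE _; exact: hX.
Qed.

End InitialState.

(** * Stochastic descent stopped on leaving a sublevel set *)

(** Used with [t = i%:R + theta], this sums the squared step sizes. *)
Lemma inv_sqr_telescope {R : realType} (t : R) : 2 <= t ->
  (t ^+ 2)^-1 <= (t - 1)^-1 - t^-1.
Proof.
move=> t2; have t0 : 0 < t by lra.
have t1 : 0 < t - 1 by lra.
have -> : (t - 1)^-1 - t^-1 = ((t - 1) * t)^-1 by field; rewrite !gt_eqF.
rewrite lef_pV2 ?posrE ?exprn_gt0 ?mulr_gt0// expr2 ler_wpM2r ?(ltW t0)//.
by rewrite gerBl.
Qed.

Lemma stopping_recursion {R : realType} (M a a' u u' x y b p q v g : R) :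
  M * (a - a') + u' <= (1 - x) * u + y -> y <= b * (p - q) ->
  M * (1 - a) + u <= g + b * (v - p) -> 0 <= x * u ->
  M * (1 - a') + u' <= g + b * (v - q).
Proof. by move=> *; lra. Qed.

Lemma failure_budget {R : realType} (a b z : R) :
  1 - a <= 3 / 10 * z -> b <= 7 / 10 * z -> 1 - z <= a - b.
Proof. by move=> *; lra. Qed.

Section Descent.
Context {R : realType} {n m : nat}.
Variables (A : 'M[R]_n) (B : 'M[R]_(n, m)) (Q : 'M[R]_n) (Ru : 'M[R]_m).
Hypotheses (n0 : (0 < n)%N) (m0 : (0 < m)%N) (hQ : posdef Q) (hRu : posdef Ru).
Variables (D : probability (n.-tuple R) R) (Sigma0 : 'M[R]_n) (Cm : R).
Hypothesis hcov : forall i j, \int[D]_x (colv x *m (colv x)^T) i j = Sigma0 i j.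
Hypothesis hSigma0 : posdef Sigma0.
Hypothesis hCm : 0 < Cm.
Hypothesis hbound : {ae D, forall x, frob_norm (colv x) ^+ 2 <= Cm}.
Variables (P : 'M[R]_n) (p : R).
Hypotheses (hP : possemidef P) (hPp : forall z, qform P z <= p * frob_dot z z).
Variables (Kstar K0 : 'M[R]_(m, n)).
Variables (sigma : R) (alpha : nat -> R).
Hypothesis sigma0 : 0 < sigma.
Context {d : measure_display} {Omega : measurableType d}.
Variable Pr : probability Omega R.
Variables (x0 : nat -> {RV Pr >-> (n.-tuple R)%type}).
Variables (eta : nat -> {RV Pr >-> (m.-tuple R)%type}).
Hypothesis hx0 : forall i E, measurable E -> distribution Pr (x0 i) E = D E.
Hypothesis heta : forall i, standard_gaussian Pr (eta i).
Hypothesis hind : independent_samples Pr x0 eta.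

Local Notation J := (trace_cost A B Q Ru P Sigma0).
Hypothesis Kmin : forall K, J Kstar <= J K.

Local Notation gap := (cost_gap A B Q Ru P Sigma0 Kstar).
Local Notation grad := (cost_grad B Ru P Sigma0 Kstar).
Local Notation G := (ctrl_hess B Ru P).
Local Notation resid := (bellman_resid A B Ru P).
Local Notation r := (sigma_min Ru).
Local Notation s := (sigma_min Sigma0).
Local Notation mean f := (\int[Pr]_w f w).

Let trm := trace_mono hcov hbound.
Let s0 : 0 < s. Proof. by case: (sigma_min_posdef n0 hSigma0). Qed.
Let r0 : 0 < r. Proof. by case: (sigma_min_posdef m0 hRu). Qed.

Let F (k : nat + nat) : set (set Omega) :=
  match k with inl i => sigma_of (x0 i) | inr i => sigma_of (eta i) end.

Let FT k : F k setT. Proof. by case: k => i; exact: sigma_ofT. Qed.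
Let FI k : setI_closed (F k). Proof. by case: k => i; exact: sigma_ofI. Qed.
Let Fm k : F k `<=` measurable.
Proof. by case: k => i; apply: sigma_of_measurable; exact: measurable_funPT. Qed.

(** The samples drawn before iteration [i], and these together with the state drawn at
    iteration [i]. *)
Let past i : pred (nat + nat) :=
  fun k => match k with inl j => (j < i)%N | inr j => (j < i)%N end.
Let past_state i : pred (nat + nat) :=
  fun k => match k with inl j => (j <= i)%N | inr j => (j < i)%N end.

Let past_sub i : subpred (past i) (past_state i).
Proof. by case=> j //= /ltnW. Qed.

Let pastS i : subpred (past i) (past i.+1).
Proof. by case=> j /= /leqW. Qed.

Local Notation x i w := (colv (x0 i w)).
Local Notation e i w := (colv (eta i w)).

Let K i (w : Omega) : 'M[R]_(m, n) :=
  pg_iterate A B Q Ru P sigma alpha (fun i => x i w) (fun i => e i w) K0 i.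

Let dep_algebra (S : pred (nat + nat)) :
  function_algebra (fun f : Omega -> R => depends_on F S f).
Proof.
split=> [c|f g|f g]; [exact: measurable_cst|exact: measurable_funD|exact: measurable_funM].
Qed.

Let dep_state (S : pred (nat + nat)) i : S (inl i) ->
  mx_in (fun f => depends_on F S f) (fun w => x i w).
Proof.
move=> Si a b; apply: (depends_on_member FT Si) => E mE.
under eq_fun do rewrite mxE.
exact: (sigma_of_comp (x0 i) (measurable_tnth a) mE).
Qed.

Let dep_noise (S : pred (nat + nat)) i : S (inr i) ->
  mx_in (fun f => depends_on F S f) (fun w => e i w).
Proof.
move=> Si a b; apply: (depends_on_member FT Si) => E mE.
under eq_fun do rewrite mxE.
exact: (sigma_of_comp (eta i) (measurable_tnth a) mE).
Qed.

Let dep_K i : mx_in (fun f => depends_on F (past i) f) (K i).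
Proof.
apply: (mx_in_pg_iterate (dep_algebra (past i))) => j ji.
by split; [exact: dep_state|exact: dep_noise].
Qed.

Let dep_gap i : depends_on F (past i) (fun w => gap (K i w)).
Proof.
have HC := dep_algebra (past i).
rewrite (_ : (fun w => gap (K i w)) = (fun w => frob_dot (K i w - Kstar)
  (G *m (K i w - Kstar) *m Sigma0))); last first.
  by apply/funext => w; exact: (cost_gapE n0 m0 hRu hP hSigma0 trm Kmin).
have dK : mx_in (fun f => depends_on F (past i) f) (fun w => K i w - Kstar).
  by apply: (mx_inB HC); [exact: dep_K|exact: mx_in_cst].
apply: (algebra_frob_dot HC) => //.
by do 2!(apply: (mx_inM HC) => //; try exact: mx_in_cst).
Qed.

(** The process is stopped when the cost leaves the sublevel set [gap <= M]; [alive i] is the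
    indicator of the event that this has not happened up to iteration [i]. *)
Variable M : R.
Hypothesis hM : gap K0 <= M.

Let below i (w : Omega) : R := \1_[set w | gap (K i w) <= M] w.

Let alive i (w : Omega) : R := \prod_(j < i.+1) below j w.

Let dep_below i : depends_on F (past i) (below i).
Proof.
apply: measurable_indic.
rewrite (_ : [set w | _] = (fun w => gap (K i w)) @^-1` `]-oo, M]); last first.
  by apply/seteqP; split => w /=; rewrite in_itv.
have := @dep_gap i measurableT _ (measurable_itv `]-oo, M]).
by rewrite setTI.
Qed.

Let aliveS i w : alive i.+1 w = alive i w * below i.+1 w.
Proof. by rewrite /alive big_ord_recr. Qed.

Let alive0 w : alive 0 w = 1.
Proof. by rewrite /alive big_ord1 /below indicE mem_set. Qed.

Let below01 i w : below i w = 0 \/ below i w = 1.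
Proof. by rewrite /below indicE; case: (_ \in _); [right|left]. Qed.

Let alive01 i w : alive i w = 0 \/ alive i w = 1.
Proof.
elim: i => [|i IH]; first by right; exact: alive0.
rewrite aliveS; case: IH => ->; first by left; rewrite mul0r.
by rewrite mul1r; exact: below01.
Qed.

Let alive_gap i w : alive i w = 1 -> gap (K i w) <= M.
Proof.
case: i => [_|i]; first exact: hM.
rewrite aliveS /below indicE; case: (boolP (_ \in _)) => [/set_mem//|_].
by rewrite mulr0 => /eqP; rewrite eq_sym oner_eq0.
Qed.

Let dep_alive i : depends_on F (past i) (alive i).
Proof.
elim: i => [|i IH].
  by rewrite (_ : alive 0 = cst 1); [exact: measurable_cst|apply/funext => w; exact: alive0].
rewrite (_ : alive i.+1 = (fun w => alive i w * below i.+1 w)); last first.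
  by apply/funext => w; exact: aliveS.
apply: measurable_funM; last exact: dep_below.
exact: depends_on_mono (@pastS i) IH.
Qed.

Let alive_ge0 i w : 0 <= alive i w.
Proof. by case: (alive01 i w) => ->. Qed.

Let aliveE i w c : alive i w * `|c| = `|alive i w * c|.
Proof. by rewrite normrM (ger0_norm (alive_ge0 i w)). Qed.

(** Functions of the samples in [S] that are almost surely bounded as long as the process is
    alive. Every polynomial in the entries of the iterate and of the current state is one, so
    that the expectations below exist. *)
Let tame i (S : pred (nat + nat)) (f : Omega -> R) : Prop :=
  depends_on F S f /\ exists c, {ae Pr, forall w, alive i w * `|f w| <= c}.

Let tame_algebra i S : function_algebra (tame i S).
Proof.
have [HC HD HM] := dep_algebra S.
split=> [c|f g [df [a fa]] [dg [b gb]]|f g [df [a fa]] [dg [b gb]]].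
- split; first exact: HC.
  exists `|c|; apply: aeW => w; case: (alive01 i w) => -> /=; rewrite ?mul0r ?mul1r//.
- split; first exact: HD.
  exists (a + b); apply: filterS2 fa gb => w fa gb.
  by rewrite (le_trans _ (lerD fa gb))// -mulrDr ler_wpM2l// ler_normD.
- split; first exact: HM.
  exists (a * b); apply: filterS2 fa gb => w fa gb.
  have : alive i w * `|f w| * (alive i w * `|g w|) <= a * b.
    by rewrite ler_pM// mulr_ge0.
  by apply: le_trans; rewrite normrM; case: (alive01 i w) => ->; rewrite ?mul0r ?mul1r.
Qed.

Let tame_rintegrable i (S : pred (nat + nat)) f : subpred (past i) S -> tame i S f ->
  depends_on F S (fun w => alive i w * f w) /\
  rintegrable Pr (fun w => alive i w * f w).
Proof.
move=> pS [df [c fc]].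
have da : depends_on F S (alive i) by exact: depends_on_mono pS (@dep_alive i).
have daf : depends_on F S (fun w => alive i w * f w) by exact: measurable_funM.
split=> //; apply: (rintegrable_bounded (c := c)).
  exact: (depends_on_measurable Fm daf).
by apply: filterS fc => w; rewrite aliveE.
Qed.

Let Kbd i w : alive i w = 1 -> r * s * frob_dot (K i w) (K i w) <= M + J Kstar.
Proof.
move=> /alive_gap; rewrite /cost_gap lerBlDr => H; apply: le_trans H.
exact: (trace_cost_ge A B n0 m0 hQ hRu hP hSigma0 trm).
Qed.

Let tame_K i S : subpred (past i) S -> mx_in (tame i S) (K i).
Proof.
move=> pS a b; split; first exact: depends_on_mono pS (@dep_K i a b).
exists (1 + (M + J Kstar) / (r * s)); apply: aeW => w.
have rs : 0 < r * s by rewrite mulr_gt0.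
have H : alive i w = 1 -> frob_dot (K i w) (K i w) <= (M + J Kstar) / (r * s).
  by move=> a1; rewrite ler_pdivlMr// mulrC Kbd.
have MJ : 0 <= (M + J Kstar) / (r * s).
  rewrite divr_ge0 ?(ltW rs)// addr_ge0//.
    by rewrite (le_trans _ hM)// subr_ge0.
  exact: ltW (trace_cost_gt0 A B n0 hQ hRu hP hSigma0 trm _).
case: (alive01 i w) => [->|a1]; first by rewrite mul0r addr_ge0.
rewrite a1 mul1r.
have : `|K i w a b| ^+ 2 <= (M + J Kstar) / (r * s).
  rewrite (le_trans _ (H a1))// real_normK ?num_real//.
  rewrite /frob_dot (bigD1 a)//= (bigD1 b)//= -expr2 -addrA lerDl.
  by rewrite addr_ge0 ?sumr_ge0// => *; rewrite -?expr2 ?sqr_ge0// sumr_ge0// => *;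
    rewrite -expr2 sqr_ge0.
have := sqr_ge0 (`|K i w a b| - 1); set k := `|_|; nra.
Qed.

Let ae_x i : {ae Pr, forall w, frob_dot (x i w) (x i w) <= Cm}.
Proof.
have := ae_state (@hx0 i) hbound; apply: filterS => w.
by rewrite sqr_frob_norm.
Qed.

Let tame_x i : mx_in (tame i (past_state i)) (fun w => x i w).
Proof.
move=> a b; split; first by apply: dep_state => /=.
exists (1 + Cm); apply: filterS (ae_x i) => w xb.
have := colv_prod_le (x i w) a a; rewrite (ord1 b) -expr2 normrX => H.
have {}H := le_trans H xb.
case: (alive01 i w) => ->; first by rewrite mul0r addr_ge0// ltW.
rewrite mul1r; have := sqr_ge0 (`|x i w a 0| - 1); set k := `|_| in H *; nra.
Qed.

Let tame_grad i (S : pred (nat + nat)) : subpred (past i) S ->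
  mx_in (tame i S) (fun w => grad (K i w)).
Proof.
move=> pS; have HC := tame_algebra i S; have [C0 _ _] := HC.
apply: (mx_inZ HC); first exact: C0.
apply: (mx_inM HC); last exact: mx_in_cst.
apply: (mx_inM HC); first exact: mx_in_cst.
by apply: (mx_inB HC); [exact: tame_K|exact: mx_in_cst].
Qed.

Let tame_resid i (S : pred (nat + nat)) : subpred (past i) S ->
  mx_in (tame i S) (fun w => resid (K i w)).
Proof.
move=> pS; have HC := tame_algebra i S.
apply: (mx_inB HC); last exact: mx_in_cst.
by apply: (mx_inM HC); [exact: mx_in_cst|exact: tame_K].
Qed.

Let past_stateN i : ~~ past_state i (inr i). Proof. by rewrite /= ltnn. Qed.
Let past_stateE i : past_state i (inl i). Proof. by rewrite /=. Qed.
Let pastN i : ~~ past i (inl i). Proof. by rewrite /= ltnn. Qed.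
Let pastNr i : ~~ past i (inr i). Proof. by rewrite /= ltnn. Qed.

Local Notation ghat i w :=
  (grad_estimate A B Q Ru P sigma (K i w) (x i w) (e i w)).

(** The pairing of the gradient estimate with a matrix is a cubic polynomial in the noise, so its
    mean involves only the moments of the noise of order at most three. *)
Lemma frob_dot_grad_estimate (L N : 'M[R]_(m, n)) (y : 'cV[R]_n) (z : 'cV[R]_m) :
  frob_dot (grad_estimate A B Q Ru P sigma L y z) N =
  \sum_a (- (sigma^-1 * Qfun A B Q Ru P y (- (L *m y))) * (N *m y) a 0) * z a 0
  + \sum_(k : 'I_m * 'I_m)
      (2 * (resid L *m y) k.1 0 * (N *m y) k.2 0) * (z k.1 0 * z k.2 0)
  + \sum_(k : 'I_m * 'I_m * 'I_m) (- sigma * G k.1.1 k.1.2 * (N *m y) k.2 0)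
      * (z k.1.1 0 * z k.1.2 0 * z k.2 0).
Proof.
have [[sR _] [sP _]] := (hRu, hP).
rewrite /grad_estimate frob_dotNl frob_dotZl frob_dot_mulmxr trmxK frob_dotC.
rewrite -[frob_dot _ z]frob_dotC Qfun_expand// frob_dotZl qformZv.
set c0 := Qfun _ _ _ _ _ _ _; set nu := N *m y; set t := resid L *m y.
have -> : \sum_a (- (sigma^-1 * c0) * nu a 0) * z a 0 = - (sigma^-1 * c0) * frob_dot z nu.
  by rewrite frob_dot_col mulr_sumr; apply: eq_bigr => a _; ring.
have -> : \sum_(k : 'I_m * 'I_m) (2 * t k.1 0 * nu k.2 0) * (z k.1 0 * z k.2 0)
    = 2 * frob_dot z t * frob_dot z nu.
  rewrite !frob_dot_col -mulrA big_distrlr /= pair_big /= mulr_sumr.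
  by apply: eq_bigr => k _; ring.
have -> : \sum_(k : 'I_m * 'I_m * 'I_m) (- sigma * G k.1.1 k.1.2 * nu k.2 0)
      * (z k.1.1 0 * z k.1.2 0 * z k.2 0) = - sigma * qform G z * frob_dot z nu.
  rewrite qform_sum frob_dot_col -mulrA big_distrlr /= pair_big /= mulr_sumr.
  by apply: eq_bigr => k _; ring.
by field; rewrite gt_eqF.
Qed.

Let noise_pre i (f : m.-tuple R -> R) E : measurable_fun setT f -> measurable E ->
  F (inr i) ((fun w => f (eta i w)) @^-1` E).
Proof. by move=> mf mE; exact: (sigma_of_comp (eta i) mf mE). Qed.

Let state_pre i (f : n.-tuple R -> R) E : measurable_fun setT f -> measurable E ->
  F (inl i) ((fun w => f (x0 i w)) @^-1` E).
Proof. by move=> mf mE; exact: (sigma_of_comp (x0 i) mf mE). Qed.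

Let mcol a : measurable_fun setT (fun z : m.-tuple R => colv z a 0).
Proof. exact: measurable_colv. Qed.

(** The estimate is unbiased: by independence the monomials in the noise and then in the state
    are replaced by their means, and only the quadratic noise terms survive. *)
Let mean_grad_inner i :
  rintegrable Pr (fun w => alive i w * frob_dot (ghat i w) (grad (K i w))) /\
  mean (fun w => alive i w * frob_dot (ghat i w) (grad (K i w))) =
  mean (fun w => alive i w * frob_dot (grad (K i w)) (grad (K i w))).
Proof.
pose S := past_state i; have HC := tame_algebra i S; have [C0 CD CM] := HC.
have tK : mx_in (tame i S) (K i) by exact: tame_K.
have tx : mx_in (tame i S) (fun w => x i w) := @tame_x i.
have tnu : mx_in (tame i S) (fun w => grad (K i w) *m x i w).
  by apply: (mx_inM HC) => //; exact: tame_grad.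
have tt : mx_in (tame i S) (fun w => resid (K i w) *m x i w).
  by apply: (mx_inM HC) => //; exact: tame_resid.
have tc : tame i S (fun w => Qfun A B Q Ru P (x i w) (- (K i w *m x i w))).
  apply: (algebra_Qfun HC) => //; apply: (mx_inN HC); exact: (mx_inM HC).
pose nu w := grad (K i w) *m x i w; pose t w := resid (K i w) *m x i w.
have t1 a : tame i S
    (fun w => - (sigma^-1 * Qfun A B Q Ru P (x i w) (- (K i w *m x i w))) * nu w a 0).
  apply: (CM _ _ _ _); last exact: tnu.
  by under eq_fun do rewrite -mulNr; exact: (CM _ _ (C0 _) tc).
have t2 (k : 'I_m * 'I_m) : tame i S (fun w => 2 * t w k.1 0 * nu w k.2 0).
  by apply: (CM _ _ _ _); [apply: (CM _ _ (C0 2)); exact: tt|exact: tnu].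
have t3 (k : 'I_m * 'I_m * 'I_m) :
    tame i S (fun w => - sigma * G k.1.1 k.1.2 * nu w k.2 0).
  by apply: (CM _ _ (C0 _)); exact: tnu.
have inst f (tf : tame i S f) := tame_rintegrable (@past_sub i) tf.
have gauss1 a := gaussian_mean1 (measurable_funPT (eta i)) (heta i) a.
have gauss2 a b := gaussian_mean2 (measurable_funPT (eta i)) (heta i) a b.
have gauss3 a b c := gaussian_mean3 (measurable_funPT (eta i)) (heta i) a b c.
have eE a w : e i w a 0 = tnth (eta i w) a by rewrite mxE.
have sumI := @mean_sum_depends_on _ _ _ Pr _ F FT FI Fm hind.
have [I1 E1] : rintegrable Pr (fun w => \sum_a
      (alive i w * (- (sigma^-1 * Qfun A B Q Ru P (x i w) (- (K i w *m x i w))) * nu w a 0))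
      * e i w a 0) /\ mean (fun w => \sum_a
      (alive i w * (- (sigma^-1 * Qfun A B Q Ru P (x i w) (- (K i w *m x i w))) * nu w a 0))
      * e i w a 0) = 0.
  have := sumI 'I_m S (inr i) _ (fun a w => e i w a 0) (fun=> 0) (past_stateN i)
    (fun a => inst _ (t1 a)) (fun a E => noise_pre i (mcol a)) _.
  case=> [a|I1 ->]; first by under eq_fun do rewrite eE.
  split=> //; rewrite -[RHS](mean_cst Pr 0); apply: eq_Rintegral => w _.
  by apply: big1 => a _; rewrite mulr0.
have [I2 E2] : rintegrable Pr (fun w => \sum_(k : 'I_m * 'I_m)
      (alive i w * (2 * t w k.1 0 * nu w k.2 0)) * (e i w k.1 0 * e i w k.2 0)) /\
    mean (fun w => \sum_(k : 'I_m * 'I_m)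
      (alive i w * (2 * t w k.1 0 * nu w k.2 0)) * (e i w k.1 0 * e i w k.2 0)) =
    mean (fun w => alive i w * (2 * frob_dot (t w) (nu w))).
  have := sumI _ S (inr i) _ (fun k w => e i w k.1 0 * e i w k.2 0)
    (fun k => (k.1 == k.2)%:R) (past_stateN i) (fun k => inst _ (t2 k))
    (fun k E => noise_pre i (measurable_funM (mcol k.1) (mcol k.2))) _.
  case=> [k|I2 ->]; first by under eq_fun do rewrite !eE.
  split=> //; apply: eq_Rintegral => w _; rewrite frob_dot_col.
  rewrite -(pair_big xpredT xpredT (fun a b =>
    alive i w * (2 * t w a 0 * nu w b 0) * (a == b)%:R))/= !mulr_sumr.
  apply: eq_bigr => a _; rewrite (bigD1 a)//= eqxx mulr1 big1 ?addr0; first by ring.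
  by move=> b ba; rewrite eq_sym (negbTE ba) mulr0.
have [I3 E3] : rintegrable Pr (fun w => \sum_(k : 'I_m * 'I_m * 'I_m)
      (alive i w * (- sigma * G k.1.1 k.1.2 * nu w k.2 0)) *
      (e i w k.1.1 0 * e i w k.1.2 0 * e i w k.2 0)) /\
    mean (fun w => \sum_(k : 'I_m * 'I_m * 'I_m)
      (alive i w * (- sigma * G k.1.1 k.1.2 * nu w k.2 0)) *
      (e i w k.1.1 0 * e i w k.1.2 0 * e i w k.2 0)) = 0.
  have := sumI _ S (inr i) _ (fun k w => e i w k.1.1 0 * e i w k.1.2 0 * e i w k.2 0)
    (fun=> 0) (past_stateN i) (fun k => inst _ (t3 k))
    (fun k E => noise_pre i (measurable_funM (measurable_funM (mcol k.1.1) (mcol k.1.2))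
      (mcol k.2))) _.
  case=> [k|I3 ->]; first by under eq_fun do rewrite !eE.
  split=> //; rewrite -[RHS](mean_cst Pr 0); apply: eq_Rintegral => w _.
  by apply: big1 => a _; rewrite mulr0.
have [I4 E4] : rintegrable Pr (fun w => alive i w * (2 * frob_dot (t w) (nu w))) /\
    mean (fun w => alive i w * (2 * frob_dot (t w) (nu w))) =
    mean (fun w => alive i w * frob_dot (grad (K i w)) (grad (K i w))).
  have pp : subpred (past i) (past i) by [].
  have [C0' _ CM'] := tame_algebra i (past i).
  have t4 (k : 'I_n * 'I_n) : tame i (past i)
      (fun w => 2 * ((resid (K i w))^T *m grad (K i w)) k.1 k.2).
    apply: (CM' _ _ (C0' 2)); apply: (mx_inM (tame_algebra i (past i))); last exact: tame_grad.
    by apply: mx_in_tr; exact: tame_resid.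
  have E4 w : alive i w * (2 * frob_dot (t w) (nu w)) = \sum_(k : 'I_n * 'I_n)
      (alive i w * (2 * ((resid (K i w))^T *m grad (K i w)) k.1 k.2)) *
      (x i w k.1 0 * x i w k.2 0).
    rewrite /t frob_dot_mulmxl /nu mulmxA -qformE qform_sum !mulr_sumr.
    by apply: eq_bigr => k _; ring.
  have [] := sumI _ (past i) (inl i) _ (fun k w => x i w k.1 0 * x i w k.2 0)
    (fun k => Sigma0 k.1 k.2) (pastN i) (fun k => tame_rintegrable pp (t4 k))
    (fun k E => state_pre i (measurable_funM
      (@measurable_colv R n k.1 0) (@measurable_colv R n k.2 0)))
    (fun k => state_prod hcov hbound (@hx0 i) k.1 k.2).
  under eq_fun do rewrite -E4.
  move=> I4 ->; split=> //; apply: eq_Rintegral => w _.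
  have [sS _] := hSigma0.
  rewrite -(bellman_resid_grad n0 m0 hRu hP hSigma0 trm Kmin (K i w)).
  set N := 2 *: _.
  have -> : frob_dot N N = 2 * frob_dot ((resid (K i w))^T *m N) Sigma0.
    by rewrite frob_dot_mulmxl trmxK {1}/N frob_dotZl frob_dotC.
  rewrite {1}/frob_dot pair_big /= !mulr_sumr.
  by apply: eq_bigr => k _; ring.
have E w : alive i w * frob_dot (ghat i w) (grad (K i w)) =
    \sum_a (alive i w * (- (sigma^-1 * Qfun A B Q Ru P (x i w) (- (K i w *m x i w))) * nu w a 0))
      * e i w a 0 +
    (\sum_(k : 'I_m * 'I_m)
      (alive i w * (2 * t w k.1 0 * nu w k.2 0)) * (e i w k.1 0 * e i w k.2 0) +
     \sum_(k : 'I_m * 'I_m * 'I_m)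
      (alive i w * (- sigma * G k.1.1 k.1.2 * nu w k.2 0)) *
      (e i w k.1.1 0 * e i w k.1.2 0 * e i w k.2 0)).
  rewrite frob_dot_grad_estimate -addrA !mulrDr !mulr_sumr.
  by congr (_ + (_ + _)); apply: eq_bigr => k _; ring.
have I23 := rintegrableD I2 I3.
under eq_fun do rewrite E.
split; first exact: rintegrableD.
by rewrite (meanD I1 I23) (meanD I2 I3) E1 E2 E3 E4 add0r addr0.
Qed.

Local Notation Ch := ((M + J Kstar) / (s * r)).
Local Notation c1 := (spectral_norm Q + 2 * spectral_norm Ru * Ch
  + 2 * p * (spectral_norm A ^+ 2 + 2 * spectral_norm B ^+ 2 * Ch)).
Local Notation c2 := (2 * (spectral_norm Ru + 2 * p * spectral_norm B ^+ 2)).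
Local Notation xi1 := (c1 * Cm `^ (3 / 2)).
Local Notation xi2 := (c2 * Cm `^ (1 / 2)).
Local Notation xi3 := (1 / sigma ^+ 2 * xi1 ^+ 2 * m%:R
  + 2 * xi1 * xi2 * m%:R * (m%:R + 2)
  + sigma ^+ 2 * xi2 ^+ 2 * m%:R * (m%:R + 2) * (m%:R + 4)).

Let p0 : 0 <= p. Proof. exact: (psd_bound_ge0 n0 hP hPp). Qed.

Let Ch0 : 0 <= Ch.
Proof.
rewrite divr_ge0 ?mulr_ge0 ?(ltW s0) ?(ltW r0)// addr_ge0//.
  by rewrite (le_trans _ hM)// subr_ge0.
exact: ltW (trace_cost_gt0 A B n0 hQ hRu hP hSigma0 trm _).
Qed.

Let Qfun_le (L : 'M[R]_(m, n)) (y : 'cV[R]_n) (z : 'cV[R]_m) :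
  frob_dot L L <= Ch ->
  Qfun A B Q Ru P y (- (L *m y) + sigma *: z) <=
  c1 * frob_dot y y + c2 * sigma ^+ 2 * frob_dot z z.
Proof.
move=> LC; rewrite /Qfun; set u := - (L *m y) + sigma *: z.
have u_le : frob_dot u u <= 2 * Ch * frob_dot y y + 2 * sigma ^+ 2 * frob_dot z z.
  rewrite (le_trans (frob_dotDD_le _ _))// !(frob_dotNl, frob_dotNr, frob_dotZl, frob_dotZr).
  have := ler_wpM2r (frob_dot_ge0 y) LC.
  have := frob_dot_mulmx_le L y; lra.
have R_le := le_trans (qform_le_spectral Ru u) (ler_wpM2l (spectral_norm_ge0 Ru) u_le).
have AB_le : frob_dot (A *m y + B *m u) (A *m y + B *m u) <=
    2 * spectral_norm A ^+ 2 * frob_dot y y + 2 * spectral_norm B ^+ 2 *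
    (2 * Ch * frob_dot y y + 2 * sigma ^+ 2 * frob_dot z z).
  rewrite (le_trans (frob_dotDD_le _ _))//.
  have := spectral_norm_dot A y; have := spectral_norm_dot B u.
  have := ler_wpM2l (sqr_ge0 (spectral_norm B)) u_le; lra.
have P_le := le_trans (hPp (A *m y + B *m u)) (ler_wpM2l p0 AB_le).
have Q_le := qform_le_spectral Q y.
apply: (le_trans (lerD (lerD Q_le R_le) P_le)).
by rewrite le_eqVlt; apply/orP; left; apply/eqP; ring.
Qed.

Let Qfun_ge0 (y : 'cV[R]_n) (u : 'cV[R]_m) : 0 <= Qfun A B Q Ru P y u.
Proof.
by rewrite /Qfun !addr_ge0 ?(posdef_semidef hQ).2 ?(posdef_semidef hRu).2 ?hP.2.
Qed.

(** Bound on the squared norm of the estimate that involves the noise only; it holds as long as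
    the process is alive. *)
Let H (z : 'cV[R]_m) : R :=
  sigma ^- 2 * (xi1 + sigma ^+ 2 * xi2 * frob_dot z z) ^+ 2 * frob_dot z z.

Let ghat_le (L : 'M[R]_(m, n)) (y : 'cV[R]_n) (z : 'cV[R]_m) :
  frob_dot L L <= Ch -> frob_dot y y <= Cm ->
  frob_dot (grad_estimate A B Q Ru P sigma L y z)
    (grad_estimate A B Q Ru P sigma L y z) <= H z.
Proof.
move=> LC yC; have := Qfun_le y z LC; have := Qfun_ge0 y (- (L *m y) + sigma *: z).
rewrite /grad_estimate frob_dotNl frob_dotNr opprK frob_dotZl frob_dotZr.
set q := Qfun _ _ _ _ _ _ _; move=> q0 qle.
have -> : frob_dot (z *m y^T) (z *m y^T) = frob_dot z z * frob_dot y y.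
  rewrite frob_dot_mulmxr trmxK -mulmxA.
  have -> : y^T *m y = (frob_dot y y)%:M.
    by rewrite [LHS]mx11_scalar frob_dotE /mxtrace big_ord1.
  by rewrite mul_mx_scalar frob_dotZr mulrC.
have z0 := frob_dot_ge0 z; have y0 := frob_dot_ge0 y.
have rt0 : 0 <= Cm `^ (1 / 2) := powR_ge0 _ _.
have rtE : Cm `^ (1 / 2) ^+ 2 = Cm.
  by rewrite -powR_mulrn ?powR_ge0// -powRrM divfK// powRr1// ltW.
have rt3 : Cm `^ (3 / 2) = Cm * Cm `^ (1 / 2).
  have -> : (3 / 2 : R) = 1 + 1 / 2 by field.
  by rewrite powRD ?gt_eqF ?implybT// powRr1// ltW.
set g := Cm `^ (1 / 2) in rt0 rtE rt3 *.
have [nQ nR] := (spectral_norm_ge0 Q, spectral_norm_ge0 Ru).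
have [nA nB] := (spectral_norm_ge0 A, spectral_norm_ge0 B).
have c1_ge0 t : 0 <= t -> 0 <= spectral_norm Q + 2 * spectral_norm Ru * t
    + 2 * p * (spectral_norm A ^+ 2 + 2 * spectral_norm B ^+ 2 * t).
  by move=> t0; rewrite !(addr_ge0, mulr_ge0).
have c10 : 0 <= c1 by exact: c1_ge0 Ch0.
have c20 : 0 <= c2 by rewrite !(addr_ge0, mulr_ge0).
rewrite /H rt3 -/g; move: c10 c20 qle; set a := c1; set b := c2; move=> a0 b0 qle.
have {}qle : q <= a * Cm + b * sigma ^+ 2 * frob_dot z z.
  by rewrite (le_trans qle)// lerD2r ler_wpM2l.
have -> : sigma^-1 * q * (sigma^-1 * q * (frob_dot z z * frob_dot y y)) =
    sigma ^- 2 * (q ^+ 2 * frob_dot y y) * frob_dot z z by field; rewrite gt_eqF.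
rewrite ler_wpM2r// ler_wpM2l ?invr_ge0 ?sqr_ge0//.
have -> : a * (Cm * g) + sigma ^+ 2 * (b * g) * frob_dot z z =
    (a * Cm + b * sigma ^+ 2 * frob_dot z z) * g by ring.
rewrite exprMn rtE ler_pM// ?sqr_ge0//.
by rewrite ler_pXn2r ?nnegrE// (le_trans q0).
Qed.

Let S i w := \sum_j tnth (eta i w) j ^+ 2.

Let SE i w : frob_dot (e i w) (e i w) = S i w.
Proof. by rewrite frob_dot_col; apply: eq_bigr => a _; rewrite mxE expr2. Qed.

(** The noise is independent of the survival up to its iteration, and the moments of the
    chi-squared distribution give [xi3]. *)
Let mean_H i : rintegrable Pr (fun w => alive i w * H (e i w)) /\
  mean (fun w => alive i w * H (e i w)) = mean (alive i) * xi3.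
Proof.
have [i1 i2 i3 [e1 e2 e3]] := gaussian_sqnorm_moments (measurable_funPT (eta i)) (heta i).
have HE w : H (e i w) = (xi1 ^+ 2 / sigma ^+ 2) * S i w ^+ 1
    + (2 * xi1 * xi2 * S i w ^+ 2 + sigma ^+ 2 * xi2 ^+ 2 * S i w ^+ 3).
  by rewrite /H SE; move: xi1 xi2 => a b; field; rewrite gt_eqF.
have I1 := rintegrableZ (xi1 ^+ 2 / sigma ^+ 2) i1.
have I2 := rintegrableZ (2 * xi1 * xi2) i2.
have I3 := rintegrableZ (sigma ^+ 2 * xi2 ^+ 2) i3.
have I23 := rintegrableD I2 I3.
have iH : rintegrable Pr (fun w => H (e i w)).
  by under eq_fun do rewrite HE; exact: rintegrableD.
have mH : mean (fun w => H (e i w)) = xi3.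
  under eq_Rintegral do rewrite HE.
  rewrite (meanD I1 I23) (meanD I2 I3) !meanZ// e1 e2 e3.
  by move: xi1 xi2 => a b; field; rewrite gt_eqF.
have preH E : measurable E -> F (inr i) ((fun w => H (e i w)) @^-1` E).
  apply: (noise_pre i (f := fun z => H (colv z))).
  have HC := @measurable_algebra R _ (m.-tuple R); have [C0 CD CM] := HC.
  have mS : measurable_fun setT (fun z : m.-tuple R => frob_dot (colv z) (colv z)).
    by apply: (algebra_frob_dot HC); exact: measurable_colv.
  apply: (CM _ _ _ mS); apply: (CM _ _ (C0 _)); apply: measurable_funX.
  by apply: (CD _ _ (C0 _)); exact: (CM _ _ (C0 _) mS).
have ia : rintegrable Pr (alive i).
  apply: (rintegrable_bounded (c := 1)).
    exact: (depends_on_measurable Fm (@dep_alive i)).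
  by apply: aeW => w; case: (alive01 i w) => ->; rewrite ?normr0 ?normr1.
have [] := mean_depends_onM FT FI Fm hind (pastNr i) (@dep_alive i) preH ia iH.
by rewrite mH.
Qed.

Local Notation gB := (spectral_norm Ru + p * spectral_norm B ^+ 2).
Local Notation Sn := (spectral_norm Sigma0).

Let u i := mean (fun w => alive i w * gap (K i w)).
Let survival i := mean (alive i).

Let gap_ge0 i w : 0 <= gap (K i w).
Proof. exact: cost_gap_ge0. Qed.

Let alive_int i : rintegrable Pr (alive i).
Proof.
apply: (rintegrable_bounded (c := 1)).
  exact: (depends_on_measurable Fm (@dep_alive i)).
by apply: aeW => w; case: (alive01 i w) => ->; rewrite ?normr0 ?normr1.
Qed.

Let alive_gap_int i : rintegrable Pr (fun w => alive i w * gap (K i w)).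
Proof.
suff /(tame_rintegrable (fun k => id))[] : tame i (past i) (fun w => gap (K i w)) by [].
split; first exact: dep_gap.
exists M; apply: aeW => w; rewrite ger0_norm//.
have M0 : 0 <= M by rewrite (le_trans _ hM)// cost_gap_ge0.
case: (alive01 i w) => aw; rewrite aw ?mul0r// mul1r; exact: alive_gap.
Qed.

Let alive_le_Ch i w : alive i w = 1 -> frob_dot (K i w) (K i w) <= Ch.
Proof.
by move=> aw; rewrite ler_pdivlMr ?mulr_gt0// mulrC [s * r]mulrC; exact: Kbd.
Qed.

(** The cost being exactly quadratic, one step changes the gap by a linear term, whose mean is
    controlled by gradient domination, and a quadratic one, whose mean is controlled by [xi3]. *)
Let descent_step i : 0 <= alpha i ->
  rintegrable Pr (fun w => alive i w * gap (K i.+1 w)) /\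
  mean (fun w => alive i w * gap (K i.+1 w)) <=
  (1 - alpha i * (4 * r * s)) * u i + alpha i ^+ 2 * (gB * Sn) * (survival i * xi3).
Proof.
move=> al0; have [I1 E1] := mean_grad_inner i; have [I2 E2] := mean_H i.
have gS0 : 0 <= gB * Sn.
  by rewrite mulr_ge0 ?addr_ge0 ?mulr_ge0 ?exprn_ge0 ?spectral_norm_ge0.
pose f w := alive i w * gap (K i w)
  + (- alpha i * (alive i w * frob_dot (ghat i w) (grad (K i w)))
     + alpha i ^+ 2 * (gB * Sn) * (alive i w * H (e i w))).
have J1 := rintegrableZ (- alpha i) I1.
have J2 := rintegrableZ (alpha i ^+ 2 * (gB * Sn)) I2.
have J12 := rintegrableD J1 J2.
have If : rintegrable Pr f := rintegrableD (alive_gap_int i) J12.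
have le_f : {ae Pr, forall w, `|alive i w * gap (K i.+1 w)| <= f w}.
  apply: filterS (ae_x i) => w xC.
  rewrite ger0_norm ?mulr_ge0 ?alive_ge0 ?gap_ge0// /f.
  case: (alive01 i w) => aw; rewrite aw; first by rewrite !(mul0r, mulr0, addr0).
  have -> : K i.+1 w = K i w + - (alpha i *: ghat i w) by [].
  rewrite !mul1r.
  rewrite (cost_gapD n0 m0 hRu hP hSigma0 trm Kmin) -addrA lerD2l.
  rewrite frob_dotNl frob_dotZl mulNr lerD2l.
  apply: (le_trans (cost_quad_le B Ru n0 hP hSigma0 hPp trm _)).
  rewrite frob_dotNl frob_dotNr opprK frob_dotZl frob_dotZr.
  set N := frob_dot _ _; have -> : gB * Sn * (alpha i * (alpha i * N)) =
    alpha i ^+ 2 * (gB * Sn) * N by ring.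
  have gSa : 0 <= alpha i ^+ 2 * (gB * Sn) by rewrite mulr_ge0 ?sqr_ge0.
  rewrite ler_wpM2l//.
  exact: ghat_le (alive_le_Ch aw) xC.
have Il : rintegrable Pr (fun w => alive i w * gap (K i.+1 w)).
  apply: rintegrable_le le_f If; apply: measurable_funM.
    exact: (depends_on_measurable Fm (@dep_alive i)).
  exact: (depends_on_measurable Fm (@dep_gap i.+1)).
split=> //; apply: (@le_trans _ _ (mean f)).
  apply: mean_le => //; apply: filterS le_f => w; apply: le_trans.
  exact: ler_norm.
rewrite /f (meanD (alive_gap_int i) J12) (meanD J1 J2) (meanZ _ I1) (meanZ _ I2) E1 E2.
have [_ Ig] : depends_on F (past i) (fun w => alive i w * frob_dot (grad (K i w)) (grad (K i w)))
    /\ rintegrable Pr (fun w => alive i w * frob_dot (grad (K i w)) (grad (K i w))).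
  apply: (tame_rintegrable (fun k => id)).
  by apply: (algebra_frob_dot (tame_algebra i (past i))); exact: tame_grad.
have dom : 4 * r * s * u i <= mean (fun w => alive i w * frob_dot (grad (K i w)) (grad (K i w))).
  rewrite /u -(meanZ _ (alive_gap_int i)).
  apply: mean_le => //; first exact: rintegrableZ.
  apply: aeW => w; rewrite mulrCA ler_wpM2l ?alive_ge0//.
  exact: (cost_grad_dom n0 m0 hRu hP hSigma0 trm Kmin).
have := ler_wpM2l al0 dom; rewrite -/(u i) -/(survival i); lra.
Qed.

Let survival_le1 i : survival i <= 1.
Proof.
rewrite -[leRHS](mean_cst Pr 1); apply: mean_le => //; first exact: rintegrable_cst.
by apply: aeW => w /=; case: (alive01 i w) => ->.
Qed.

Let u_ge0 i : 0 <= u i.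
Proof. by apply: Rintegral_ge0 => w _; rewrite mulr_ge0 ?alive_ge0. Qed.

Let xi3_ge0 : 0 <= xi3.
Proof.
have [_ E] := mean_H 0; have a0 : survival 0 = 1.
  by rewrite /survival -[RHS](mean_cst Pr 1); apply: eq_Rintegral => w _; exact: alive0.
move: E; rewrite -/(survival 0) a0 mul1r => <-; apply: Rintegral_ge0 => w _.
rewrite mulr_ge0 ?alive_ge0// /H mulr_ge0 ?frob_dot_ge0// mulr_ge0 ?sqr_ge0//.
by rewrite invr_ge0 sqr_ge0.
Qed.

(** On the event of stopping at [i.+1] the cost gap exceeds [M], so that the mass [M] times the
    probability of this event is taken out of the mean gap. *)
Let stop_step i : 0 <= alpha i -> M * (survival i - survival i.+1) + u i.+1 <=
  mean (fun w => alive i w * gap (K i.+1 w)).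
Proof.
move=> /descent_step[I _].
have Ia : rintegrable Pr (fun w => alive i w + -1 * alive i.+1 w).
  by apply: rintegrableD => //; exact: rintegrableZ.
have -> : survival i - survival i.+1 = mean (fun w => alive i w + -1 * alive i.+1 w).
  by rewrite meanD ?meanZ ?mulN1r//; exact: rintegrableZ.
rewrite -(meanZ _ Ia) /u -(meanD (rintegrableZ M Ia) (alive_gap_int i.+1)).
apply: mean_le => //; first by apply: rintegrableD => //; exact: rintegrableZ.
apply: aeW => w; rewrite aliveS /below indicE.
have a0 := alive_ge0 i w.
case: (boolP (_ \in _)) => [_|/negP gM]; first by rewrite /= !mulr1; lra.
have {}gM : M <= gap (K i.+1 w).
  by rewrite leNgt; apply/negP => gM'; apply: gM; rewrite inE /=; exact: ltW.
by rewrite /= !mulr0 mul0r !addr0 mulrC ler_wpM2l.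
Qed.

Let u_le i : 0 <= alpha i ->
  u i.+1 <= mean (fun w => alive i w * gap (K i.+1 w)).
Proof.
move=> /descent_step[I _]; apply: (mean_le (alive_gap_int i.+1) I).
apply: aeW => w; rewrite aliveS mulrAC ler_piMr ?mulr_ge0 ?alive_ge0//.
by case: (below01 i.+1 w) => ->.
Qed.

Variables (theta : R).
Local Notation mu := (4 * s * r).
Local Notation beta := (4 * (gB * Sn) * xi3 / mu ^+ 2).
Hypothesis theta2 : 2 <= theta.
Hypothesis alphaE : forall i, alpha i = 2 / mu * (1 / (i%:R + theta)).
Hypothesis beta_le : beta <= theta * J K0.

Let mu0 : 0 < mu. Proof. by rewrite !mulr_gt0. Qed.

Let si_gt i : 2 <= i%:R + theta.
Proof. by rewrite (le_trans theta2)// lerDr. Qed.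

Let beta0 : 0 <= beta.
Proof.
rewrite divr_ge0 ?sqr_ge0// !mulr_ge0 ?xi3_ge0 ?addr_ge0 ?mulr_ge0 ?exprn_ge0 ?spectral_norm_ge0//.
Qed.

Let alpha_ge0 i : 0 <= alpha i.
Proof.
by rewrite alphaE !mulr_ge0 ?invr_ge0 ?mul1r ?invr_ge0 ?(ltW mu0)// (le_trans _ (si_gt i)).
Qed.

Let step i : mean (fun w => alive i w * gap (K i.+1 w)) <=
  (1 - 2 / (i%:R + theta)) * u i + beta / (i%:R + theta) ^+ 2.
Proof.
have [_ st] := descent_step (alpha_ge0 i).
have t2 := si_gt i; have t0 : 0 < i%:R + theta by lra.
apply: (le_trans st); rewrite alphaE.
have -> : 2 / mu * (1 / (i%:R + theta)) * (4 * r * s) = 2 / (i%:R + theta).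
  by field; rewrite !gt_eqF.
rewrite lerD2l.
have -> : (2 / mu * (1 / (i%:R + theta))) ^+ 2 * (gB * Sn) * (survival i * xi3) =
    beta / (i%:R + theta) ^+ 2 * survival i.
  by move: xi3 => X; field; rewrite !gt_eqF.
by rewrite ler_piMr// divr_ge0 ?sqr_ge0.
Qed.

Let gap0_le : gap K0 <= J K0.
Proof. by rewrite /cost_gap gerBl ltW// (trace_cost_gt0 A B n0 hQ hRu hP hSigma0 trm). Qed.

Let u0 : u 0 = gap K0.
Proof.
rewrite /u -[RHS](mean_cst Pr); apply: eq_Rintegral => w _.
by rewrite alive0 mul1r.
Qed.

(** With [t = i%:R + theta] and [c = theta * J K0], the recursion preserves [u i <= c / t] since
    [(1 - 2 / t) * (c / t) + c / t ^+ 2 = c * (t - 1) / t ^+ 2 <= c / (t + 1)]. *)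
Let u_bound i : u i <= theta * J K0 / (i%:R + theta).
Proof.
have J0 := ltW (trace_cost_gt0 A B n0 hQ hRu hP hSigma0 trm K0).
elim: i => [|i IH].
  have t0 : 0 < theta by rewrite (lt_le_trans _ theta2).
  by rewrite u0 add0r mulrAC divff ?mul1r ?gap0_le// gt_eqF.
apply: (le_trans (u_le (alpha_ge0 i))); apply: (le_trans (step i)).
have t2 := si_gt i; have t0 : 0 < i%:R + theta by lra.
have -> : i.+1%:R + theta = i%:R + theta + 1 by rewrite -natr1; ring.
move: (i%:R + theta) t2 t0 IH => t t2 t0 IH.
have bl := beta_le; have b0 := beta0; move: (beta) bl b0 => b bl b0.
set c := theta * J K0 in bl IH *.
have w0 : 0 <= 1 - 2 / t by rewrite subr_ge0 ler_pdivrMr//; lra.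
apply: (@le_trans _ _ ((1 - 2 / t) * (c / t) + c / t ^+ 2)).
  by rewrite lerD// ?ler_wpM2l// ler_wpM2r// invr_ge0 exprn_ge0// ltW.
have -> : (1 - 2 / t) * (c / t) + c / t ^+ 2 = c * ((t - 1) / t ^+ 2).
  by field; rewrite gt_eqF.
rewrite ler_wpM2l ?(le_trans b0)//.
rewrite ler_pdivrMr ?exprn_gt0// mulrC ler_pdivlMr; last by lra.
have -> : (t - 1) * (t + 1) = t ^+ 2 - 1 by ring.
by rewrite gerBl.
Qed.

(** The maximal inequality for the stopped process: the step bounds sum up, the squared step
    sizes through [inv_sqr_telescope]. *)
Let stop_bound i : M * (1 - survival i) + u i <=
  gap K0 + beta * ((theta - 1)^-1 - (i%:R + theta - 1)^-1).
Proof.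
elim: i => [|i IH].
  have -> : survival 0 = 1.
    by rewrite /survival -[RHS](mean_cst Pr 1); apply: eq_Rintegral => w _; exact: alive0.
  by rewrite u0 add0r !subrr !mulr0 add0r addr0.
have st := le_trans (stop_step (alpha_ge0 i)) (step i).
have tele : beta / (i%:R + theta) ^+ 2 <=
    beta * ((i%:R + theta - 1)^-1 - (i.+1%:R + theta - 1)^-1).
  rewrite ler_wpM2l//; have -> : i.+1%:R + theta - 1 = i%:R + theta by rewrite -natr1; ring.
  exact: inv_sqr_telescope.
apply: (stopping_recursion st tele IH).
by rewrite mulr_ge0 ?u_ge0// divr_ge0// (le_trans _ (si_gt i)).
Qed.

Variables (zeta eps : R) (T : nat).
Hypotheses (zeta0 : 0 < zeta) (eps0 : 0 < eps).
Hypothesis ME : M = 10 * zeta^-1 * J K0.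
Hypothesis hT : 40 / (7 * mu * eps ^+ 2 * zeta) * theta * J K0 <= T%:R.

(** Failure at time [T] means either that the process has stopped, which has probability at most
    [3 / 10 * zeta] by the maximal inequality, or that it has survived with a large gap, which
    has probability at most [7 / 10 * zeta] by Markov's inequality. *)
Lemma descent_whp :
  ((1 - zeta)%:E <= Pr [set w | (frob_norm (K T w - Kstar) <= eps)%R])%E.
Proof.
have J0 := trace_cost_gt0 A B n0 hQ hRu hP hSigma0 trm K0.
have th2 := theta2; have T0 : 0 <= T%:R :> R by rewrite ler0n.
have aT : 1 - survival T <= 3 / 10 * zeta.
  have t2 := si_gt T.
  have inv_le : (theta - 1)^-1 <= 2 / theta.
    by rewrite ler_pdivlMr ?ler_pdivrMl; lra.
  have : M * (1 - survival T) <= J K0 + theta * J K0 * (2 / theta).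
    have := stop_bound T; have := u_ge0 T; have := gap0_le.
    have : beta * ((theta - 1)^-1 - (T%:R + theta - 1)^-1) <= theta * J K0 * (2 / theta).
      rewrite ler_pM//; first by rewrite subr_ge0 lef_pV2 ?posrE; lra.
      by rewrite (le_trans _ inv_le)// gerBl invr_ge0; lra.
    by lra.
  have -> : J K0 + theta * J K0 * (2 / theta) = 3 * J K0.
    by field; rewrite gt_eqF//; lra.
  rewrite ME -ler_pdivlMl ?mulr_gt0 ?invr_gt0//.
  have -> : (10 * zeta^-1 * J K0)^-1 * (3 * J K0) = 3 / 10 * zeta by field; rewrite !gt_eqF.
  by [].
have uT : u T <= 7 / 10 * zeta * (r * s * eps ^+ 2).
  have t2 := si_gt T; have t0 : 0 < T%:R + theta by lra.
  apply: (le_trans (u_bound T)); rewrite ler_pdivrMr//.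
  have : 40 / (7 * mu * eps ^+ 2 * zeta) * theta * J K0 <= T%:R + theta.
    by rewrite (le_trans hT)// lerDl; lra.
  have q0 : 0 < 7 / 10 * zeta * (r * s * eps ^+ 2) by rewrite !mulr_gt0 ?exprn_gt0.
  rewrite -(ler_pM2l q0); apply: le_trans.
  by rewrite le_eqVlt; apply/orP; left; apply/eqP; field; rewrite !gt_eqF.
pose good := [set w | frob_norm (K T w - Kstar) <= eps].
have goodE : good = (fun w => frob_dot (K T w - Kstar) (K T w - Kstar)) @^-1` `]-oo, eps ^+ 2].
  apply/seteqP; split=> w; rewrite /good /= in_itv /= -sqr_frob_norm;
    by rewrite ler_pXn2r ?nnegrE ?frob_norm_ge0// ltW.
have mgood : measurable good.
  rewrite goodE -[_ @^-1` _]setTI.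
  have dd : depends_on F (past T) (fun w => frob_dot (K T w - Kstar) (K T w - Kstar)).
    have HC := dep_algebra (past T).
    by apply: (algebra_frob_dot HC); apply: (mx_inB HC); do ?[exact: dep_K|exact: mx_in_cst].
  exact: (depends_on_measurable Fm dd).
have Ig : rintegrable Pr (\1_good : Omega -> R).
  by apply: integrable_indic.
have gE : Pr good = (mean (\1_good : Omega -> R))%:E.
  by rewrite /Rintegral integral_indic// setIT fineK ?fin_num_measure.
rewrite -/good gE lee_fin.
(* The indicator of failure is at most [1 - alive T + q * (alive T * gap)]. *)
pose q := (r * s * eps ^+ 2)^-1.
have q0 : 0 < q by rewrite invr_gt0 !mulr_gt0 ?exprn_gt0.
have Iq := rintegrableZ (- q) (alive_gap_int T).
have le_good : mean (fun w => alive T w + - q * (alive T w * gap (K T w))) <=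
    mean (\1_good : Omega -> R).
  apply: mean_le => //; first exact: rintegrableD.
  apply: aeW => w; rewrite indicE.
  case: (boolP (w \in good)) => wg /=.
    have : 0 <= q * (alive T w * gap (K T w)) by rewrite !mulr_ge0 ?alive_ge0 ?(ltW q0).
    by case: (alive01 T w) => ->; lra.
  have : eps ^+ 2 < frob_dot (K T w - Kstar) (K T w - Kstar).
    by rewrite ltNge; apply: contra wg; rewrite goodE inE /= in_itv.
  have := cost_gap_ge n0 m0 hRu hP hSigma0 trm Kmin (K T w).
  move=> gapT epsT; case: (alive01 T w) => ->; first by rewrite !(mul0r, mulr0) addr0.
  rewrite !mul1r mulNr [leRHS](_ : _ = 0)// subr_le0.
  rewrite -[1](mulVf (x := r * s * eps ^+ 2)); last by rewrite gt_eqF// !mulr_gt0 ?exprn_gt0.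
  rewrite ler_wpM2l ?(ltW q0)// (le_trans _ gapT)// ler_wpM2l ?mulr_ge0 ?ltW//.
apply: le_trans le_good; rewrite (meanD (alive_int T) Iq) (meanZ _ (alive_gap_int T)).
rewrite -/(u T) -/(survival T).
rewrite mulNr; apply: (failure_budget aT).
rewrite /q ler_pdivrMl; last by rewrite !mulr_gt0 ?exprn_gt0.
by rewrite [leRHS]mulrC.
Qed.

End Descent.

(** * Convergence with high probability *)

Theorem theorem4p1 (R : realType) (n m : nat)
    (A : 'M[R]_n) (B : 'M[R]_(n, m)) (Q : 'M[R]_n) (Ru : 'M[R]_m)
    (hAB : stabilizable A B) (hQ : posdef Q) (hRu : posdef Ru)
    (D : probability (n.-tuple R) R) (Sigma0 : 'M[R]_n) (Cm : R)
    (hmean : forall i, \int[D]_x colv x i 0 = 0)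
    (hcov : forall i j, \int[D]_x (colv x *m (colv x)^T) i j = Sigma0 i j)
    (hSigma0 : posdef Sigma0)
    (hCm : 0 < Cm)
    (hbound : {ae D, forall x, frob_norm (colv x) ^+ 2 <= Cm})
    (Pstar : 'M[R]_n)
    (hPstar : posdef Pstar) (hPstarE : riccati_solution A B Q Ru Pstar)
    (N : nat) (hN : (1 <= N)%N)
    (QN : 'M[R]_n) (hQN : QN^T = QN) (hQNP : possemidef (QN - Pstar))
    (h : nat) (hh : (h < N)%N)
    (Kt : nat -> 'M[R]_(m, n))
    (Kstar : 'M[R]_(m, n)) (K0 : 'M[R]_(m, n))
    (sigma : R) (hsigma : 0 < sigma)
    (zeta : R) (hzeta0 : 0 < zeta) (hzeta1 : zeta < 1)
    (varsigma : R) (hvarsigma : 0 < varsigma)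
    (d : measure_display) (Omega : measurableType d) (Pr : probability Omega R)
    (x0 : nat -> {RV Pr >-> (n.-tuple R)%type})
    (eta : nat -> {RV Pr >-> (m.-tuple R)%type})
    (hx0 : forall i E, measurable E -> distribution Pr (x0 i) E = D E)
    (heta : forall i, standard_gaussian Pr (eta i))
    (hind : independent_samples Pr x0 eta) :
  let Pt := policy_seq A B Q Ru Kt N QN h.+1 in
  let J := surrogate_cost A B Q Ru D Pt in
  let Pmax := spectral_norm Pstar
              + cond_number Pstar * star_norm Pstar (QN - Pstar) in
  let a := sigma_min Q / 2 in
  let C3 := 2 * (spectral_norm Ru + (Pmax + a) * spectral_norm B ^+ 2) in
  let mu := 4 * sigma_min Sigma0 * sigma_min Ru in
  let L := C3 * spectral_norm Sigma0 in
  let Ch := (10 * zeta^-1 * J K0 + J Kstar)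
            / (sigma_min Sigma0 * sigma_min Ru) in
  let xi1 := (spectral_norm Q + 2 * spectral_norm Ru * Ch
              + 2 * (Pmax + a) * (spectral_norm A ^+ 2
                                  + 2 * spectral_norm B ^+ 2 * Ch))
             * Cm `^ (3 / 2) in
  let xi2 := 2 * (spectral_norm Ru + 2 * (Pmax + a) * spectral_norm B ^+ 2)
             * Cm `^ (1 / 2) in
  let xi3 := 1 / sigma ^+ 2 * xi1 ^+ 2 * m%:R
             + 2 * xi1 * xi2 * m%:R * (m%:R + 2)
             + sigma ^+ 2 * xi2 ^+ 2 * m%:R * (m%:R + 2) * (m%:R + 4) in
  let theta := Num.max 2 (2 * L * xi3 / (mu ^+ 2 * J K0)) in
  let alpha := fun i : nat => 2 / mu * (1 / (i%:R + theta)) in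
  let T := `|Num.ceil (40 / (7 * mu * varsigma ^+ 2 * zeta)
                       * theta * J K0)|%N in
  let K := fun (w : Omega) (i : nat) =>
    pg_iterate A B Q Ru Pt sigma alpha
      (fun i => colv (x0 i w)) (fun i => colv (eta i w)) K0 i in
  (forall K' : 'M[R]_(m, n), J Kstar <= J K') ->
  spectral_norm (Pt - riccati_seq A B Q Ru N QN h.+1) <= a ->
  ((1 - zeta)%:E <= Pr [set w | (frob_norm (K w T - Kstar) <= varsigma)%R])%E.
Proof.
move=> Pt; rewrite (funext (surrogate_costE hcov hbound A B Q Ru Pt)).
move=> J Pmax a C3 mu L Ch xi1 xi2 xi3 theta alpha T K Kmin Pclose.
have [nm|] := boolP ((0 < n) && (0 < m))%N; last first.
  (* Without states or controls all gains are equal. *)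
  rewrite negb_and -!eqn0Ngt => nm0.
  have mx0 (X : 'M[R]_(m, n)) : X = 0.
    by apply/matrixP => i j; have := ltn_ord i; have := ltn_ord j; lia.
  rewrite [X in Pr X](_ : _ = setT); last first.
    by apply/seteqP; split => // w _; rewrite /= (mx0 (_ - _)) frob_norm0 ltW.
  by rewrite probability_setT lee_fin gerBl ltW.
have [n0 m0] := andP nm.
have pQN : possemidef QN.
  split=> // z; rewrite -(subrK Pstar QN) qformD addr_ge0//; first exact: hQNP.2.
  exact: (posdef_semidef hPstar).2.
have pPt : possemidef Pt.
  by apply: backward_ind => // s P' pP'; exact: policy_op_psd.
have Pt_le z : qform Pt z <= (Pmax + a) * frob_dot z z.
  rewrite -(subrK (riccati_seq A B Q Ru N QN h.+1) Pt) qformD addrC mulrDl.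
  rewrite lerD//; first exact: riccati_seq_bound.
  by rewrite (le_trans (qform_le_spectral _ _))// ler_wpM2r ?frob_dot_ge0.
have trm := trace_mono hcov hbound.
have J0 : 0 < J K0 := trace_cost_gt0 A B n0 hQ hRu pPt hSigma0 trm K0.
have Js : 0 < J Kstar := trace_cost_gt0 A B n0 hQ hRu pPt hSigma0 trm Kstar.
have gapM : cost_gap A B Q Ru Pt Sigma0 Kstar K0 <= 10 * zeta^-1 * J K0.
  have z1 : 1 <= 10 * zeta^-1 by rewrite ler_pdivlMr//; lra.
  have : J K0 <= 10 * zeta^-1 * J K0 by rewrite ler_peMl// ltW.
  by apply: le_trans; rewrite gerBl ltW.
have [s0 _ _] := sigma_min_posdef n0 hSigma0.
have [r0 _ _] := sigma_min_posdef m0 hRu.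
have theta2 : 2 <= theta by rewrite le_max lexx.
have beta_le : 4 * ((spectral_norm Ru + (Pmax + a) * spectral_norm B ^+ 2)
    * spectral_norm Sigma0) * xi3 / (4 * sigma_min Sigma0 * sigma_min Ru) ^+ 2
    <= theta * J K0.
  have : 2 * L * xi3 / (mu ^+ 2 * J K0) <= theta by rewrite le_max lexx orbT.
  rewrite -(ler_pM2r J0); apply: le_trans; rewrite le_eqVlt; apply/orP; left; apply/eqP.
  rewrite /L /C3 /mu; move: (xi3) (J K0) J0 => X j j0.
  by field; rewrite !gt_eqF.
apply: (@descent_whp R n m A B Q Ru n0 m0 hQ hRu D Sigma0 Cm hcov hSigma0 hCm hbound
  Pt (Pmax + a) pPt Pt_le Kstar K0 sigma alpha hsigma d Omega Pr x0 eta hx0 heta hind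
  Kmin _ gapM theta theta2 (fun=> erefl) beta_le zeta varsigma T) => //.
have := ceil_ge (40 / (7 * mu * varsigma ^+ 2 * zeta) * theta * J K0).
move=> /le_trans; apply; rewrite -[T%:R]/((T%:Z)%:~R) ler_int /T abszE.
exact: ler_norm.
Qed.
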